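(* Let $K$ be a field and let $\mathcal{P}$ be a parallelogram polyomino. Let $h(t)$ be the numerator of the reduced Hilbert–Poincaré series of the coordinate ring $K[\mathcal{P}]$. Then $h(t)=\widetilde{r}_{\mathcal{P}}(t)$, where $\widetilde{r}_{\mathcal{P}}(t)=\sum_{k=0}^{r(\mathcal{P})}|\widetilde{\mathcal{R}}_k|\,t^k$ is the polynomial counting the switching-equivalence classes of sets of $k$ non-attacking rooks on $\mathcal{P}$.
   Context: **Cells and polyominoes.** $\mathbb{N}=\{0,1,2,\dots\}$. For $a=(i,j)$, $b=(k,l)\in\mathbb{N}^2$ with $i<k$, $j<l$, the proper interval $[a,b]$ is $\{(r,s)\in\mathbb{N}^2: i\le r\le k,\ j\le s\le l\}$; its diagonal corners are $a,b$ and its anti-diagonal corners are $(i,l)$ and $(k,j)$. A cell is an interval $C=[a,a+(1,1)]$; $\ell(C)=a$ is its lower left corner, and its vertices are its four corners. For a finite collection $\mathcal{P}$ of cells, $V(\mathcal{P})$ is the set of all vertices of cells of $\mathcal{P}$. A proper interval $[a,b]$ is an inner interval (also called a rectangle) of $\mathcal{P}$ if all cells contained in $[a,b]$ belong to $\mathcal{P}$. **Parallelogram polyominoes.** A north-east path is a sequence of points of $\mathbb{N}^2$ in which each consecutive pair is an east step $(a,b),(a+1,b)$ or a north step $(a,b),(a,b+1)$. Let $\mathcal{S}_1:(a_0,b_0),\dots,(a_k,b_k)$ and $\mathcal{S}_2:(c_0,d_0),\dots,(c_k,d_k)$ be north-east paths with the same first point and the same last point. $\mathcal{S}_1$ lies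 above $\mathcal{S}_2$ if for all $1\le i,j\le k-1$ we have $b_i>d_j$ whenever $a_i=c_j$ (so the two paths meet only at their endpoints, $\mathcal S_1$ starts with a north step and $\mathcal S_2$ with an east step). The parallelogram polyomino $\mathcal{P}=(\mathcal{S}_1,\mathcal{S}_2)$ is the collection of cells in the region bounded above by $\mathcal{S}_1$ and below by $\mathcal{S}_2$. **Coordinate ring.** Let $S=K[x_v: v\in V(\mathcal{P})]$ (standard graded). The polyomino ideal $I_{\mathcal{P}}$ is generated by all binomials $x_ax_b-x_cx_d$, where $[a,b]$ is an inner interval of $\mathcal{P}$ with anti-diagonal corners $c,d$. Put $K[\mathcal{P}]=S/I_{\mathcal{P}}$. Its Hilbert–Poincaré series $\sum_{k\ge 0}\dim_K K[\mathcal{P}]_k\,t^k$ equals $h(t)/(1-t)^{d}$ with $d$ the Krull dimension of $K[\mathcal{P}]$ and $h(t)\in\mathbb{Z}[t]$; this defines $h(t)$. **Rooks.** A set of non-attacking rooks on $\mathcal{P}$ is a set of cells of $\mathcal{P}$ no two of which lie in the same row or the same column of cells (cells in the same row have lower left corners with equal second coordinate; in the same column, equal first coordinate). $\mathcal{R}_k$ is the set of all sets of $k$ non-attacking rooks ($\mathcal{R}_0=\{\varnothing\}$), and the rook number $r(\mathcal{P})$ is the largest $k$ with $\mathcal{R}_k\neq\varnothing$. For a rectangle $[(i,j),(k,l)]$ of $\mathcal{P}$, its diagonal cells are those with lower left corners $(i,j)$ and $(k-1,l-1)$, and its antidiagonal cells are those with lower left corners $(i,l-1)$ and $(k-1,j)$.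 Two non-attacking rooks $R_1,R_2$ are switching rooks if they are the diagonal (resp. antidiagonal) cells of a rectangle of $\mathcal{P}$; if $R_1',R_2'$ are the antidiagonal (resp. diagonal) cells of that rectangle and $R_1,R_2\in F\in\mathcal{R}_k$, replacing $F$ by $(F\setminus\{R_1,R_2\})\cup\{R_1',R_2'\}\in\mathcal{R}_k$ is called a switch. $F_1,F_2\in\mathcal{R}_k$ are equivalent, $F_1\sim F_2$, if $F_2$ is obtained from $F_1$ by finitely many (possibly zero) switches. $\widetilde{\mathcal{R}}_k=\mathcal{R}_k/\sim$. *)

(* Defs.v *)
From HB Require Import structures.
From mathcomp Require Import all_boot all_order all_algebra ring_quotient.
From mathcomp Require Import finmap boolp.
From mathcomp Require Import mpoly.

Set Implicit Arguments.
Unset Strict Implicit.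
Unset Printing Implicit Defensive.

Import GRing.Theory.

Local Open Scope nat_scope.

(* A cell [a, a + (1,1)] is represented by its lower left corner a, so that   *)
(* points and cells are both pairs of naturals.                               *)
Notation point := (nat * nat)%type.
Notation cell := (nat * nat)%type.

Definition cell_vertices (c : cell) : seq point :=
  [:: c; (c.1.+1, c.2); (c.1, c.2.+1); (c.1.+1, c.2.+1)].

Definition vertices (P : {fset cell}) : {fset point} :=
  seq_fset tt (flatten [seq cell_vertices c | c <- P]).

Definition cells_in (a b : point) : seq cell :=
  [seq (i, j) | i <- index_iota a.1 b.1, j <- index_iota a.2 b.2].

Definition inner_interval (P : {fset cell}) (a b : point) : bool :=
  [&& a.1 < b.1, a.2 < b.2 & all (fun c => c \in P) (cells_in a b)].

Definition ne_step (p q : point) : bool :=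
  (q == (p.1.+1, p.2)) || (q == (p.1, p.2.+1)).

Definition ne_path (k : nat) (s : seq point) : Prop :=
  size s = k.+1 /\ sorted ne_step s.

Definition pt (s : seq point) (i : nat) : point := nth (0, 0) s i.

(* The requirements on the first steps only matter for paths without interior *)
(* points (k <= 1) and for regions of width one (e.g. ENN and NNE), where the *)
(* inequality below is vacuous and does not decide which path is on top.      *)
Definition lies_above (k : nat) (s1 s2 : seq point) : Prop :=
  [/\ pt s1 1 = ((pt s1 0).1, (pt s1 0).2.+1),
      pt s2 1 = ((pt s2 0).1.+1, (pt s2 0).2) &
      forall i j : nat, 1 <= i <= k.-1 -> 1 <= j <= k.-1 ->
        (pt s1 i).1 = (pt s2 j).1 -> (pt s2 j).2 < (pt s1 i).2].

(* A north-east path contains exactly one east step (i, b), (i.+1, b) in each *)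
(* column i that it crosses, and it contains both of these points only if it  *)
(* makes that step; the cell (i, j) is below the step iff j < b.              *)
Definition region_cell (s1 s2 : seq point) (c : cell) : Prop :=
  exists b d : nat,
    [/\ (c.1, b) \in s1, (c.1.+1, b) \in s1,
        (c.1, d) \in s2, (c.1.+1, d) \in s2 & d <= c.2 < b].

Definition parallelogram_polyomino (P : {fset cell}) : Prop :=
  exists (k : nat) (s1 s2 : seq point),
    [/\ ne_path k s1 /\ ne_path k s2,
        pt s1 0 = pt s2 0, pt s1 k = pt s2 k,
        lies_above k s1 s2 &
        forall c : cell, c \in P <-> region_cell s1 s2 c].

Section Rooks.
Variable P : {fset cell}.

Definition nonattacking (F : {set P}) : bool :=
  [forall x in F, forall y in F, (x != y) ==>
     ((val x).1 != (val y).1) && ((val x).2 != (val y).2)].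

Definition rooks (k : nat) : {set {set P}} :=
  [set F | nonattacking F & #|F| == k].

Definition rook_number : nat := \max_(k < #|{: P}|.+1 | rooks k != set0) k.

Definition diag_cells (a b : point) : {set P} :=
  [set c | val c \in [:: a; (b.1.-1, b.2.-1)]].

Definition anti_cells (a b : point) : {set P} :=
  [set c | val c \in [:: (a.1, b.2.-1); (b.1.-1, a.2)]].

(* #|D| == 2 rules out the rectangles consisting of a single cell.             *)
Definition replace (D E F G : {set P}) : bool :=
  [&& #|D| == 2, D \subset F & G == (F :\: D) :|: E].

Definition switch (F G : {set P}) : bool :=
  [exists a : vertices P, exists b : vertices P,
     inner_interval P (val a) (val b) &&
     (replace (diag_cells (val a) (val b)) (anti_cells (val a) (val b)) F G
      || replace (anti_cells (val a) (val b)) (diag_cells (val a) (val b)) F G)].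

Definition rook_classes (k : nat) : {set {set {set P}}} :=
  equivalence_partition (connect switch) (rooks k).

Definition switching_rook_poly : {poly int} :=
  (\sum_(k < rook_number.+1) (#|rook_classes k|)%:R *: 'X^k)%R.

End Rooks.

Local Open Scope ring_scope.

Definition ideal_gen (R : comNzRingType) (G : R -> Prop) : {pred R} :=
  [pred f | `[< exists s : seq (R * R),
                  (forall p, p \in s -> G p.2) /\
                  f = \sum_(p <- s) p.1 * p.2 >]].

Section CoordinateRing.
Variables (K : fieldType) (P : {fset cell}).

Local Notation vpoly := {mpoly K[#|{: vertices P}|]}.

Definition xvar (v : vertices P) : vpoly := 'X_(enum_rank v).

Definition inner_minor (f : vpoly) : Prop :=
  exists a b c d : vertices P,
    [/\ inner_interval P (val a) (val b),
        val c = ((val a).1, (val b).2), val d = ((val b).1, (val a).2) &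
        f = xvar a * xvar b - xvar c * xvar d].

Definition polyomino_ideal : {pred vpoly} := ideal_gen inner_minor.

Lemma polyomino_ideal_closed : idealr_closed polyomino_ideal.
Proof.
split=> [||a u v].
- by apply/asboolP; exists [::]; rewrite big_nil.
- apply/asboolP=> -[s [sG /(congr1 (meval (fun=> 0)))]].
  rewrite rmorph1 rmorph_sum big1_seq /= => [/eqP|p /sG]; first by rewrite oner_eq0.
  case=> a' [b [c [d [_ _ _ ->]]]].
  by rewrite rmorphM rmorphB !rmorphM /= !mevalXU !mul0r subrr mulr0.
- move=> /asboolP[s [sG ->]] /asboolP[t [tG ->]]; apply/asboolP.
  exists ([seq (a * p.1, p.2) | p <- s] ++ t); split=> [p|].
    by rewrite mem_cat => /orP[/mapP[q /sG ? ->]|/tG].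
  rewrite big_cat big_map /= mulr_sumr; congr (_ + _).
  by apply: eq_bigr => p _; rewrite mulrA.
Qed.

HB.instance Definition _ :=
  isIdealr.Build vpoly polyomino_ideal polyomino_ideal_closed.

Definition coord_ring := {ideal_quot polyomino_ideal}.

HB.instance Definition _ := GRing.ComNzRing.on coord_ring.

Definition to_coord_ring (f : vpoly) : coord_ring :=
  (\pi_({ideal_quot polyomino_ideal}) f)%qT.

Definition coord_scale (c : K) (x : coord_ring) : coord_ring :=
  to_coord_ring c%:MP * x.

Lemma coord_scaleA c d x :
  coord_scale c (coord_scale d x) = coord_scale (c * d) x.
Proof. by rewrite /coord_scale mulrA /to_coord_ring -rmorphM -mpolyCM. Qed.

Lemma coord_scale1 : left_id 1 coord_scale.
Proof. by move=> x; rewrite /coord_scale /to_coord_ring mpolyC1 rmorph1 mul1r. Qed.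

Lemma coord_scaleDr : right_distributive coord_scale +%R.
Proof. by move=> c x y; rewrite /coord_scale mulrDr. Qed.

Lemma coord_scaleDl x : {morph coord_scale^~ x : c d / c + d}.
Proof.
by move=> c d; rewrite /coord_scale /to_coord_ring mpolyCD rmorphD mulrDl.
Qed.

HB.instance Definition _ := GRing.Zmodule_isLmodule.Build K coord_ring
  coord_scaleA coord_scale1 coord_scaleDr coord_scaleDl.

Definition graded_piece (k : nat) (x : coord_ring) : Prop :=
  exists2 f : vpoly, f \is k.-homog & x = to_coord_ring f.

End CoordinateRing.

Definition has_dim (K : fieldType) (V : lmodType K) (W : V -> Prop) (n : nat)
    : Prop :=
  exists b : 'I_n -> V,
    [/\ forall i, W (b i),
        forall c : 'I_n -> K, \sum_i c i *: b i = 0 -> forall i, c i = 0 &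
        forall v, W v -> exists c : 'I_n -> K, v = \sum_i c i *: b i].

Definition prime_ideal (R : comNzRingType) (I : {pred R}) : Prop :=
  idealr_closed I /\ prime_idealr_closed I.

Definition prime_chain (R : comNzRingType) (n : nat) (p : nat -> {pred R})
    : Prop :=
  (forall i, (i <= n)%N -> prime_ideal (p i)) /\
  (forall i, (i < n)%N -> {subset p i <= p i.+1} /\
                          exists2 x, x \in p i.+1 & x \notin p i).

Definition has_krull_dim (R : comNzRingType) (d : nat) : Prop :=
  (exists p : nat -> {pred R}, prime_chain d p) /\
  (forall (n : nat) (p : nat -> {pred R}), prime_chain n p -> (n <= d)%N).

(* The power series identity (1 - t)^d * (\sum_k H k t^k) = h(t).             *)
Definition series_numerator (d : nat) (H : nat -> nat) (h : {poly int})
    : Prop :=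
  forall n : nat,
    \sum_(i < n.+1) ((1 - 'X : {poly int}) ^+ d)`_i * (H (n - i)%N)%:R = h`_n.

Definition is_h_polynomial (K : fieldType) (P : {fset cell}) (h : {poly int})
    : Prop :=
  exists (d : nat) (H : nat -> nat),
    [/\ has_krull_dim (coord_ring K P) d,
        forall k, has_dim (@graded_piece K P k) (H k) &
        series_numerator d H h].

(* Main.v *)
Require Import Defs.
From mathcomp Require Import all_boot all_order all_algebra finmap.
From HB Require Import structures.
From mathcomp Require Import ring_quotient mpoly.
From mathcomp Require Import zify ring boolp.

(** The vertex set of a parallelogram polyomino is a planar distributive lattice
    for the componentwise order: a pair of incomparable vertices and its
    componentwise minimum and maximum are the corners of an inner interval.  So
    the generators of the ideal are the relations x_u x_v = x_(min) x_(max), and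
    K[P] is a Hibi ring.  Both sides of the claim reduce to counting chains.

    Algebra.  The relations rewrite every monomial into one supported on a
    multichain of vertices ([straighten]).  The ring map sending x_(i,j) to
    s_i t_j kills the ideal, and a multichain is recovered from its image by
    sorting columns and rows separately, so multichain monomials of degree k form
    a basis of the k-th graded piece ([graded_piece_dim]).  The Krull dimension
    is the number of vertices of a maximal chain ([coord_ring_krull_dim]).
    Killing in turn the vertices of such a chain gives enough primes.  Conversely
    a strict chain of n + 1 primes yields n algebraically independent elements,
    and the number of multichains grows too slowly for n to be larger.

    Rooks.  A switch preserves the sets of occupied rows and columns.  Two rooks in
    antidiagonal position are always opposite corners of a rectangle of P, so
    switches bring any configuration to one in which every two rooks are in
    diagonal position, and such a configuration is determined by its rows and
    columns.  So the classes of k rooks are counted by the chains of k cells that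
    are strictly increasing in both coordinates ([card_rook_classes]).

    Counting.  For a vertex v let M_v(t) and S_v(t) be the generating series of
    the multichains of vertices below v and of the strict chains of cells whose
    upper right corners are below v.  If v has two predecessors a and b in the
    lattice, with minimum c, inclusion-exclusion gives
      (1 - t) M_v = M_a + M_b - M_c   and   S_v = S_a + S_b - (1 - t) S_c,
    and if v has a single predecessor a then (1 - t) M_v = M_a and S_v = S_a.
    By induction (1 - t)^(r + 1) M_v = S_v where r is the rank of v
    ([multichains_numerator]).  At the top vertex this is the theorem, since r + 1
    is then the Krull dimension. *)

Set Implicit Arguments.
Unset Strict Implicit.
Unset Printing Implicit Defensive.

Import GRing.Theory.
Local Open Scope nat_scope.
Arguments pt : simpl never.

(** * The vertices of a parallelogram polyomino *)

Definition leq2 (u v : point) : bool := (u.1 <= v.1) && (u.2 <= v.2).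

(** The region between the two paths, seen as a sublattice of the plane: the
    rectangle spanned by an antidiagonal pair of vertices stays inside the region,
    and any vertex is reached from any vertex below it by unit steps. *)
Record planar_lattice (P : {fset cell}) (o e : point) : Prop := PlanarLattice {
  pl_bot : o \in vertices P;
  pl_top : e \in vertices P;
  pl_bounds : forall v : point, v \in vertices P -> leq2 o v && leq2 v e;
  pl_rect : forall i j k l x y,
    (i, l) \in vertices P -> (k, j) \in vertices P ->
    i <= x <= k -> j <= y <= l -> (x, y) \in vertices P;
  pl_step : forall u v : point, u \in vertices P -> v \in vertices P ->
    leq2 u v -> u != v -> exists w : point, [/\ w \in vertices P, ne_step w v & leq2 u w];
  pl_cell : forall c : cell, (c \in P) =
    ((c.1, c.2.+1) \in vertices P) && ((c.1.+1, c.2) \in vertices P) }.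

Lemma mem_vertices (P : {fset cell}) (v : point) :
  reflect (exists2 c : cell, c \in P & v \in cell_vertices c) (v \in vertices P).
Proof.
rewrite seq_fsetE; apply: (iffP flatten_mapP) => -[c cP vc]; by exists c.
Qed.

Section Paths.
Variables (k : nat) (s : seq point).
Hypothesis s_path : ne_path k s.

Lemma ne_path_step n : n < k -> ne_step (pt s n) (pt s n.+1).
Proof.
case: s_path => sz /(sortedP (0, 0)) h nk; apply: h; by rewrite sz.
Qed.

Lemma ne_path_sum n : n <= k ->
  (pt s n).1 + (pt s n).2 = (pt s 0).1 + (pt s 0).2 + n.
Proof.
elim: n => [|n IH] nk; first by rewrite addn0.
have := ne_path_step nk; have := IH (ltnW nk).
by move=> h /orP[]/eqP-> /=; lia.
Qed.

Lemma ne_path_mono m n : m <= n <= k ->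
  (pt s m).1 <= (pt s n).1 <= (pt s m).1 + (n - m).
Proof.
elim: n => [|n IH] /andP[mn nk]; first (have -> : m = 0; lia).
have [->|mn'] := eqVneq m n.+1; first by lia.
have {}IH : (pt s m).1 <= (pt s n).1 <= (pt s m).1 + (n - m) by apply: IH; lia.
by case/orP: (ne_path_step nk) => /eqP-> /=; lia.
Qed.

(** A discrete intermediate value theorem: the first coordinate grows by at most
    one at a time, so a path that passes from column c or earlier to a column
    beyond c makes an east step out of column c. *)
Lemma ne_path_cross i j c : i <= j <= k -> (pt s i).1 <= c < (pt s j).1 ->
  exists n, [/\ i <= n < j, (pt s n).1 = c & (pt s n.+1) = (c.+1, (pt s n).2)].
Proof.
elim: j => [|j IH] ijk ic.
  by have i0 : i = 0; [lia|subst i; lia].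
have [eij|nij] := eqVneq i j.+1; first by rewrite eij in ic; lia.
have jk : j < k by lia.
have [cj|cj] := ltnP c (pt s j).1.
  by have [||n [h1 h2 h3]] := IH; [lia|lia|exists n; split=> //; lia].
have sj := ne_path_step jk.
have cj' : (pt s j).1 = c by case/orP: sj => /eqP sj; rewrite sj /= in ic; lia.
exists j; split=> //; first lia.
by case/orP: sj => /eqP sj; rewrite sj /= in ic *; [congr (_, _); lia|lia].
Qed.

Lemma mem_ne_path p : reflect (exists2 n, n <= k & p = pt s n) (p \in s).
Proof.
case: s_path => sz _; apply: (iffP (nthP (0, 0))) => -[n nk].
  by move=> <-; exists n => //; rewrite sz in nk.
by move=> ->; exists n => //; rewrite sz.
Qed.

End Paths.

Section Region.
Variables (P : {fset cell}) (k : nat) (s1 s2 : seq point).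
Hypotheses (path1 : ne_path k s1) (path2 : ne_path k s2).
Hypotheses (first_eq : pt s1 0 = pt s2 0) (last_eq : pt s1 k = pt s2 k).
Hypothesis above : lies_above k s1 s2.
Hypothesis cellsP : forall c : cell, c \in P <-> region_cell s1 s2 c.

Local Notation o := (pt s1 0).
Local Notation e := (pt s1 k).
Local Notation a n := (pt s1 n).1.
Local Notation b n := (pt s2 n).1.

(** The first steps differ and the last points agree, so there is at least one
    interior point. *)
Lemma polyomino_paths_gt1 : 1 < k.
Proof.
case: above => h1 h2 _; case: path1 => z1 _; case: path2 => z2 _.
case: k last_eq z1 z2 => [|[|//]] le z1 z2; move: h1 h2 le first_eq.
  by rewrite {1}/pt nth_default ?z1.
by move=> -> -> [] h; rewrite -first_eq in h *; lia.
Qed.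

(** The n-th points of both paths lie on the same antidiagonal.  There the upper
    path starts to the left, and each coordinate moves by at most one per step, so
    it cannot get to the right without meeting the lower path, which is excluded at
    interior points. *)
Lemma paths_separate n : 0 < n < k -> a n < b n.
Proof.
have k1 := polyomino_paths_gt1.
case: above => h1 h2 h3.
elim: n => [//|[_ _|n IH nk]]; first by rewrite h1 h2 /= -first_eq.
have {}IH : a n.+1 < b n.+1 by apply: IH; lia.
have/andP[_ ha] : a n.+1 <= a n.+2 <= a n.+1 + (n.+2 - n.+1).
  by apply: (ne_path_mono path1); lia.
have/andP[hb _] : b n.+1 <= b n.+2 <= b n.+1 + (n.+2 - n.+1).
  by apply: (ne_path_mono path2); lia.
have := h3 n.+2 n.+2; have := ne_path_sum path1 (n := n.+2).
have := ne_path_sum path2 (n := n.+2); rewrite -first_eq; lia.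
Qed.

(** The region is cut along antidiagonals: its n-th slice is the set of points
    between the n-th point of the upper path and that of the lower one. *)
Definition in_region (p : point) n :=
  [&& p.1 + p.2 == o.1 + o.2 + n, n <= k, a n <= p.1 & p.1 <= b n].

(** The upper left and lower right corners of a cell are consecutive points of one
    antidiagonal; the cell belongs to P when both are in the slice. *)
Lemma cell_region (c : cell) : (c \in P) <->
  exists n, [/\ c.1 + c.2.+1 = o.1 + o.2 + n, n <= k & a n <= c.1 < b n].
Proof.
rewrite cellsP; case: c => x y /=; split.
  case=> t [d /= []] /(mem_ne_path path1)[n1 n1k e1] _ _.
  case/(mem_ne_path path2)=> n2 n2k e2 /andP[dy yt].
  have := ne_path_sum path1 n1k; have := ne_path_sum path2 n2k.
  rewrite -e1 -e2 -first_eq /= => h2 h1.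
  exists (x + y.+1 - (o.1 + o.2)); split; [lia|lia|].
  have := @ne_path_mono _ _ path1 (x + y.+1 - (o.1 + o.2)) n1.
  have := @ne_path_mono _ _ path2 n2 (x + y.+1 - (o.1 + o.2)).
  rewrite -e1 -e2 /=; lia.
case=> n [/= hn nk /andP[an bn]].
have bk : b n <= a k.
  by rewrite last_eq; have := @ne_path_mono _ _ path2 n k; lia.
have [||m [hm1 hm2 hm3]] := @ne_path_cross _ _ path1 n k x; [lia|lia|].
have a0 : b 0 <= a n.
  by rewrite -first_eq; have := @ne_path_mono _ _ path1 0 n; lia.
have [||l [hl1 hl2 hl3]] := @ne_path_cross _ _ path2 0 n x; [lia|lia|].
exists (pt s1 m).2, (pt s2 l).2; split=> /=.
- by apply/(mem_ne_path path1); exists m; [lia|rewrite -hm2; case: (pt s1 m)].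
- by apply/(mem_ne_path path1); exists m.+1; [lia|].
- by apply/(mem_ne_path path2); exists l; [lia|rewrite -hl2; case: (pt s2 l)].
- by apply/(mem_ne_path path2); exists l.+1; [lia|].
have := @ne_path_sum _ _ path1 m; have := @ne_path_sum _ _ path2 l.
rewrite -first_eq; lia.
Qed.

(** By [paths_separate] an interior slice has at least two points, so each of its
    points has a neighbour in the slice, and the two span a cell of P. *)
Lemma vertex_region (v : point) : v \in vertices P <-> exists n, in_region v n.
Proof.
have k1 := polyomino_paths_gt1.
split=> [/mem_vertices[c /cell_region[n [hn nk /andP[an bn]]] hv]|[n /and4P[]]].
  have n0 : 0 < n < k.
    have: n != 0 by apply/eqP=> n0; move: an bn; rewrite n0 -first_eq; lia.
    have: n != k by apply/eqP=> n0; move: an bn; rewrite n0 -last_eq; lia.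
    lia.
  have := @ne_path_mono _ _ path1 n.-1 n; have := @ne_path_mono _ _ path1 n n.+1.
  have := @ne_path_mono _ _ path2 n.-1 n; have := @ne_path_mono _ _ path2 n n.+1.
  move=> h1 h2 h3 h4; move: hv; rewrite !inE => /or4P[]/eqP->.
  - by exists n.-1; apply/and4P; split; lia.
  - by exists n; apply/and4P; split; rewrite /=; lia.
  - by exists n; apply/and4P; split; rewrite /=; lia.
  by exists n.+1; apply/and4P; split; rewrite /=; lia.
case: v => x y /= /eqP hn nk an bn.
have := @ne_path_sum _ _ path1 n; have := @ne_path_sum _ _ path2 n.
rewrite -first_eq => sb sa.
case: above => h1 h2 _.
have [n0|n0] := eqVneq n 0.
  rewrite n0 -first_eq in an bn hn.
  apply/mem_vertices; exists (x, y); last by rewrite inE eqxx.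
  apply/cell_region; exists 1; rewrite h1 h2 -first_eq /=; split; lia.
have [nk'|nk'] := eqVneq n k.
  rewrite nk' -last_eq in an bn hn.
  have sep := @paths_separate k.-1.
  have := @ne_path_mono _ _ path1 k.-1 k; have := @ne_path_mono _ _ path2 k.-1 k.
  have := @ne_path_sum _ _ path1 k.-1; have := @ne_path_sum _ _ path2 k.-1.
  have := @ne_path_sum _ _ path1 k; rewrite -first_eq -last_eq => h3 h4 h5 h6 h7.
  apply/mem_vertices; exists (x.-1, y.-1).
    by apply/cell_region; exists k.-1; split; rewrite /=; lia.
  by rewrite !inE /= !xpair_eqE; lia.
have sep := @paths_separate n.
apply/mem_vertices; have [xb|xb] := ltnP x (b n).
  exists (x, y.-1); last by rewrite !inE /= !xpair_eqE; lia.
  by apply/cell_region; exists n; split; rewrite /=; lia.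
exists (x.-1, y); last by rewrite !inE /= !xpair_eqE; lia.
by apply/cell_region; exists n; split; rewrite /=; lia.
Qed.

Lemma region_planar_lattice : planar_lattice P o e.
Proof.
have k1 := polyomino_paths_gt1.
have bounds v n : in_region v n ->
    [/\ o.1 <= v.1, o.2 <= v.2, v.1 <= e.1 & v.2 <= e.2].
  case/and4P=> /eqP hn nk an bn.
  have := @ne_path_mono _ _ path1 0 n; have := @ne_path_mono _ _ path2 0 n.
  have := @ne_path_mono _ _ path1 n k; have := @ne_path_mono _ _ path2 n k.
  have := @ne_path_sum _ _ path1 k; rewrite -first_eq -last_eq.
  split; lia.
split.
- by apply/vertex_region; exists 0; rewrite /in_region -first_eq; lia.
- apply/vertex_region; exists k; rewrite /in_region -last_eq.
  by have := @ne_path_sum _ _ path1 k; lia.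
- by move=> v /vertex_region[n /bounds[? ? ? ?]]; rewrite /leq2; lia.
- move=> i j k' l x y /vertex_region[n1 h1] /vertex_region[n2 h2] hx hy.
  have /= [? ? ? ?] := bounds _ _ h1; have /= [? ? ? ?] := bounds _ _ h2.
  case/and4P: h1 => /= /eqP e1 n1k a1 b1; case/and4P: h2 => /= /eqP e2 n2k a2 b2.
  apply/vertex_region; pose n := x + y - (o.1 + o.2); exists n.
  have hn : x + y = o.1 + o.2 + n by rewrite /n; lia.
  have nk : n <= k by have := @ne_path_sum _ _ path1 k; lia.
  have := @ne_path_mono _ _ path1 n1 n; have := @ne_path_mono _ _ path1 n n1.
  have := @ne_path_mono _ _ path2 n2 n; have := @ne_path_mono _ _ path2 n n2.
  by move=> h3 h4 h5 h6; apply/and4P; split; rewrite /=; lia.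
- move=> u v /vertex_region[n1 h1] /vertex_region[n2 h2] uv nuv.
  have /= [q1 q2 q3 q4] := bounds _ _ h1; have /= [q5 q6 q7 q8] := bounds _ _ h2.
  case/and4P: h1 => /= /eqP e1 n1k a1 b1; case/and4P: h2 => /= /eqP e2 n2k a2 b2.
  case: u v uv nuv q1 q2 q3 q4 q5 q6 q7 q8 e1 a1 b1 e2 a2 b2 => [x1 y1] [x2 y2] /=.
  rewrite /leq2 xpair_eqE /= => uv nuv q1 q2 q3 q4 q5 q6 q7 q8 e1 a1 b1 e2 a2 b2.
  have n12 : n1 < n2 by lia.
  have := @ne_path_mono _ _ path1 n1 n2.-1; have := @ne_path_mono _ _ path1 n2.-1 n2.
  have := @ne_path_mono _ _ path2 n1 n2.-1; have := @ne_path_mono _ _ path2 n2.-1 n2.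
  have sep := @paths_separate n2.-1 => h3 h4 h5 h6.
  (* Step back west when the previous slice allows it, otherwise south. *)
  have [hl|hl] := boolP ((x1 < x2) && (a n2.-1 < x2)).
    exists (x2.-1, y2); split; rewrite /ne_step /= ?xpair_eqE; try lia.
    by apply/vertex_region; exists n2.-1; apply/and4P; split; rewrite /=; lia.
  have n2k' : n2.-1 = 0 -> b n2.-1 = a n2.-1 by move=> ->; rewrite -first_eq.
  exists (x2, y2.-1); split; rewrite /ne_step /= ?xpair_eqE; try lia.
  by apply/vertex_region; exists n2.-1; apply/and4P; split; rewrite /=; lia.
move=> c; apply/idP/andP.
  case/cell_region=> n [hn nk /andP[an bn]].
  by split; apply/vertex_region; exists n; apply/and4P; split; rewrite /=; lia.
case=> /vertex_region[n1 /and4P[/= /eqP hn n1k a1 b1]].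
case/vertex_region=> n2 /and4P[/= /eqP hn2 n2k a2 b2].
have en : n2 = n1 by lia.
by rewrite en in b2; apply/cell_region; exists n1; split; lia.
Qed.

End Region.

(** * Counting chains of vertices and chains of cells *)

Definition lt2 (u v : point) : bool := (u.1 < v.1) && (u.2 < v.2).

Fixpoint multichains (P : {fset cell}) (n : nat) (v : point) : nat :=
  if n is m.+1 then
    \sum_(u : vertices P | leq2 (fsval u) v) multichains P m (fsval u)
  else 1.

Fixpoint strict_chains (P : {fset cell}) (n : nat) (v : point) : nat :=
  if n is m.+1 then \sum_(c : P | lt2 (fsval c) v) strict_chains P m (fsval c)
  else 1.

Lemma sum_incl_excl (T : finType) (F : T -> nat) (p p12 p1 p2 q : pred T) :
  (forall t, p t + p12 t = p1 t + p2 t + q t) ->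
  \sum_(t | p t) F t + \sum_(t | p12 t) F t =
  \sum_(t | p1 t) F t + \sum_(t | p2 t) F t + \sum_(t | q t) F t.
Proof.
move=> h; rewrite ![\sum_(t | _ t) _]big_mkcond -!big_split; apply: eq_bigr => t _.
by move: (h t); case: (p t) (p12 t) (p1 t) (p2 t) (q t) => [] [] [] [] [] //=; lia.
Qed.

Lemma sum_val_pred1 (A : {fset point}) (F : point -> nat) (v : point) :
  v \in A -> \sum_(u : A | fsval u == v) F (fsval u) = F v.
Proof. by move=> vA; rewrite (big_pred1 [` vA]%fset) // => u; rewrite /= -val_eqE. Qed.

Lemma leq_expl m n d : m <= n -> m ^ d <= n ^ d.
Proof. by case: d => // d mn; rewrite leq_exp2r. Qed.

Lemma ne_step_east x y : ne_step (x, y) (x.+1, y).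
Proof. by rewrite /ne_step eqxx. Qed.

Lemma ne_step_north x y : ne_step (x, y) (x, y.+1).
Proof. by rewrite /ne_step eqxx orbT. Qed.

Section Counting.
Variables (P : {fset cell}) (o e : point).
Hypothesis PL : planar_lattice P o e.
Local Notation L := (vertices P).
Local Notation M := (multichains P).
Local Notation S := (strict_chains P).

Definition rank (v : point) := v.1 + v.2 - (o.1 + o.2).

(** With a single predecessor w, the vertices below v are v and those below w; with
    two predecessors, the square that they form with v is a cell of P. *)
Variant predecessor_spec (v : point) : Prop :=
  | PredBot of v = o
  | PredOne (w : point) of w \in L & ne_step w v &
      (forall u : point, u \in L -> leq2 u v = (u == v) || leq2 u w)
  | PredTwo x y of v = (x.+1, y.+1) & (x, y) \in P & (x, y) \in L &
      (x, y.+1) \in L & (x.+1, y) \in L.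

Lemma predecessorP (v : point) : v \in L -> predecessor_spec v.
Proof.
move=> vL; have [->|nv] := eqVneq v o; first exact: PredBot.
have ov : leq2 o v by case/andP: (pl_bounds PL vL).
have nv' : o != v by rewrite eq_sym.
have [w [wL wv ow]] := pl_step PL (pl_bot PL) vL ov nv'.
have [/existsP[w' /andP[w'v nww']]|uniq_w] :=
    boolP [exists w' : L, ne_step (val w') v && (val w' != w)].
  clear nv nv' ov ow; case: w' w'v nww' => -[x' y'] w'L /=.
  case: v w vL wL wv => x y [x'' y''] vL wL wv w'v nww'.
  move: w'v wv nww'; rewrite /ne_step /= !xpair_eqE /= => h1 h2 h3.
  have [l1 l2] : (x.-1, y) \in L /\ (x, y.-1) \in L.
    have [hx|hx] := eqVneq x' x.
      have [-> ->] : x.-1 = x'' /\ y = y'' by lia.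
      have [-> ->] : x = x' /\ y''.-1 = y' by lia.
      by [].
    have [-> ->] : x.-1 = x' /\ y = y' by lia.
    have [-> ->] : x = x'' /\ y'.-1 = y'' by lia.
    by [].
  have [ex ey] : x = x.-1.+1 /\ y = y.-1.+1 by lia.
  have cP : (x.-1, y.-1) \in P by rewrite (pl_cell PL) /= -ex -ey l1 l2.
  apply: (@PredTwo _ x.-1 y.-1); rewrite -?ex -?ey //.
  by apply/mem_vertices; exists (x.-1, y.-1); rewrite // inE eqxx.
(* A step down from v towards u lands on a predecessor of v, hence on w. *)
apply: (PredOne wL wv) => u uL; have [->|nu] /= := eqVneq u v.
  by rewrite /leq2 !leqnn.
apply/idP/idP => [uv|uw].
  have [w' [w'L w'v uw']] := pl_step PL uL vL uv nu.
  suff <- : w' = w by [].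
  apply/eqP; apply: contraNT uniq_w => nw; apply/existsP.
  by exists [` w'L]%fset; rewrite /= w'v.
clear - uw wv; move: uw wv; rewrite /leq2 /ne_step => h /orP[]/eqP-> /=; lia.
Qed.

Lemma planar_ind (Q : point -> Prop) :
  Q o ->
  (forall v w : point, v \in L -> w \in L -> ne_step w v ->
     (forall u : point, u \in L -> leq2 u v = (u == v) || leq2 u w) -> Q w -> Q v) ->
  (forall x y, (x.+1, y.+1) \in L -> (x, y) \in P -> (x, y) \in L ->
     (x, y.+1) \in L -> (x.+1, y) \in L ->
     Q (x, y) -> Q (x, y.+1) -> Q (x.+1, y) -> Q (x.+1, y.+1)) ->
  forall v : point, v \in L -> Q v.
Proof.
move=> Q0 Q1 Q2 v; have [n] := ubnP (v.1 + v.2); elim: n v => // n IH v vn vL.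
case: (predecessorP vL) => [-> //|w wL wv h|x y ev cP l0 l1 l2].
  by apply: (Q1 _ _ vL wL wv h); apply: IH => //; move: wv vn => /orP[]/eqP-> /=; lia.
by move: vn vL; rewrite ev /= => vn vL; apply: Q2 => //; apply: IH => //=; lia.
Qed.

Lemma rank_step (w v : point) : w \in L -> ne_step w v -> rank v = (rank w).+1.
Proof.
move=> wL; have := pl_bounds PL wL; rewrite /rank /leq2.
by move=> h /orP[]/eqP-> /=; lia.
Qed.

Lemma sum_below_one (F : point -> nat) (v w : point) :
  v \in L -> ne_step w v ->
  (forall u : point, u \in L -> leq2 u v = (u == v) || leq2 u w) ->
  \sum_(u : L | leq2 (fsval u) v) F (fsval u) =
    F v + \sum_(u : L | leq2 (fsval u) w) F (fsval u).
Proof.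
move=> vL wv h; have := @sum_incl_excl L (fun u => F (fsval u))
  (fun u => leq2 (fsval u) v) pred0 (fun u => leq2 (fsval u) w) pred0
  (fun u => fsval u == v).
rewrite big_pred0_eq !addn0 sum_val_pred1 // addnC => -> // u.
rewrite h ?fsvalP // !addn0; have [->|] := eqVneq (fsval u) v; last by rewrite addn0.
by move: wv; rewrite /leq2 => /orP[]/eqP-> /=; lia.
Qed.

Lemma sum_below_two (F : point -> nat) x y : (x.+1, y.+1) \in L ->
  \sum_(u : L | leq2 (fsval u) (x.+1, y.+1)) F (fsval u) +
    \sum_(u : L | leq2 (fsval u) (x, y)) F (fsval u) =
  F (x.+1, y.+1) + \sum_(u : L | leq2 (fsval u) (x, y.+1)) F (fsval u)
    + \sum_(u : L | leq2 (fsval u) (x.+1, y)) F (fsval u).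
Proof.
move=> vL; rewrite -addnA [RHS]addnC -[in RHS](sum_val_pred1 F vL).
apply: (@sum_incl_excl L (fun u => F (fsval u))) => u.
by move: (fsval u : point) => [a b]; rewrite /leq2 xpair_eqE /=; lia.
Qed.

Lemma sum_cells_two (F : point -> nat) x y : (x, y) \in P ->
  \sum_(c : P | lt2 (fsval c) (x.+1, y.+1)) F (fsval c) +
    \sum_(c : P | lt2 (fsval c) (x, y)) F (fsval c) =
  F (x, y) + \sum_(c : P | lt2 (fsval c) (x, y.+1)) F (fsval c)
    + \sum_(c : P | lt2 (fsval c) (x.+1, y)) F (fsval c).
Proof.
move=> cP; rewrite -addnA [RHS]addnC -[in RHS](sum_val_pred1 F cP).
apply: (@sum_incl_excl P (fun u => F (fsval u))) => u.
by move: (fsval u : point) => [a b]; rewrite /lt2 xpair_eqE /=; lia.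
Qed.

Lemma upper_right_vertex (c : cell) : c \in P -> (c.1.+1, c.2.+1) \in L.
Proof. by move=> cP; apply/mem_vertices; exists c; rewrite // !inE eqxx !orbT. Qed.

(** No cell has v as its upper right corner, for otherwise v would have two
    predecessors. *)
Lemma sum_cells_one (F : point -> nat) (v w : point) : v \in L -> ne_step w v ->
  (forall u : point, u \in L -> leq2 u v = (u == v) || leq2 u w) ->
  \sum_(c : P | lt2 (fsval c) v) F (fsval c) = \sum_(c : P | lt2 (fsval c) w) F (fsval c).
Proof.
move=> vL wv h; apply: eq_bigl => -[[x y] cP] /=.
have := h _ (upper_right_vertex cP); rewrite /leq2 /lt2 /= => ->.
case: eqP => //= ev; move: (cP); rewrite (pl_cell PL) /= => /andP[l1 l2].
have := h _ l1; have := h _ l2; rewrite -ev /leq2 !xpair_eqE /=; lia.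
Qed.

Lemma multichains_bot n : M n o = 1.
Proof.
elim: n => //= n IH; rewrite -[RHS]IH -[RHS](sum_val_pred1 (M n) (pl_bot PL)).
apply: eq_bigl => u; have := pl_bounds PL (fsvalP u).
move: (fsval u : point) => [a b]; case: (o) => c d.
by rewrite /leq2 xpair_eqE /=; lia.
Qed.

Lemma strict_chains_bot n : S n.+1 o = 0.
Proof.
rewrite /= big1 // => c co.
have cL : fsval c \in L by apply/mem_vertices; exists (fsval c); rewrite ?fsvalP // inE eqxx.
by have := pl_bounds PL cL; move: co; rewrite /leq2 /lt2; lia.
Qed.

(** Polynomial growth of degree at most the rank; this is the only bound on the
    Hilbert function that the Krull dimension needs. *)
Lemma multichains_bound (v : point) : v \in L ->
  forall n, M n v <= (2 * n.+1) ^ rank v.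
Proof.
move: v; apply: planar_ind.
- by move=> n; rewrite multichains_bot expn_gt0.
- move=> v w vL wL wv h IH n; rewrite (rank_step wL wv).
  elim: n => [|n IHn]; first by rewrite /= expn_gt0.
  rewrite /= (sum_below_one _ vL wv h) -/(M n.+1 w).
  apply: leq_trans (leq_add IHn (IH n.+1)) _.
  have : (2 * n.+1) ^ rank w <= (2 * n.+2) ^ rank w by apply: leq_expl; lia.
  rewrite !expnS; nia.
move=> x y vL cP l0 l1 l2 _ IH1 IH2 n.
have r1 := @rank_step (x, y.+1) (x.+1, y.+1) l1 (ne_step_east _ _).
have r2 : rank (x, y.+1) = rank (x.+1, y) by rewrite /rank /=; lia.
rewrite r1; elim: n => [|n IHn]; first by rewrite /= expn_gt0.
have := sum_below_two (M n) vL; rewrite -!/(M n.+1 _).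
have := IH1 n.+1; have := IH2 n.+1; rewrite -r2.
have : (2 * n.+1) ^ rank (x, y.+1) <= (2 * n.+2) ^ rank (x, y.+1).
  by apply: leq_expl; lia.
move: IHn; rewrite !expnS; nia.
Qed.

Local Open Scope ring_scope.

(** Multiplication of the generating series of f by 1 - t. *)
Definition backward_difference (f : nat -> int) (n : nat) : int :=
  f n - (if n is m.+1 then f m else 0).
Local Notation D := backward_difference.

Lemma iter_backward_difference d f n :
  \sum_(i < n.+1) ((1 - 'X : {poly int}) ^+ d)`_i * f (n - i)%N = iter d D f n.
Proof.
elim: d n => [|d IH] n.
  rewrite big_ord_recl /= expr0 coefC /= mul1r subn0 big1 ?addr0 // => i _.
  by rewrite coefC /= mul0r.
rewrite iterS {1}/D -IH exprS mulrBl mul1r.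
under eq_bigr do rewrite coefB mulrBl.
rewrite sumrB; congr (_ - _).
rewrite big_ord_recl /= coefXM mul0r add0r; case: n => [|n].
  by rewrite big_ord0.
rewrite -IH; apply: eq_bigr => i _.
by rewrite coefXM /= subSS.
Qed.

Lemma iter_backward_differenceD d f g :
  iter d D (fun n => f n + g n) =1 (fun n => iter d D f n + iter d D g n).
Proof.
by elim: d => // d IH n /=; rewrite /D; case: n => [|n]; rewrite !IH; ring.
Qed.

Lemma iter_backward_differenceN d f :
  iter d D (fun n => - f n) =1 (fun n => - iter d D f n).
Proof.
by elim: d => // d IH n /=; rewrite /D; case: n => [|n]; rewrite !IH; ring.
Qed.

Lemma eq_iter_backward_difference d f g : f =1 g -> iter d D f =1 iter d D g.
Proof.
by move=> fg; elim: d => //= d IH n; rewrite /D; case: n => [|n]; rewrite !IH.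
Qed.

(** Both sides satisfy the same recursion over the predecessors of v.  With two
    predecessors a, b and their minimum c, where r is the rank of v, the factor (1 - t)^r
    turns M_c into (1 - t) S_c; the term t S_c counts the chains through the cell
    whose upper right corner is v. *)
Theorem multichains_numerator (v : point) : v \in L -> forall n,
  iter (rank v).+1 D (fun n => (M n v)%:R) n = (S n v)%:R.
Proof.
move: v; apply: planar_ind.
- move=> n; rewrite (_ : rank o = 0%N) /=; last by rewrite /rank subnn.
  rewrite /D; case: n => [|n]; first by rewrite subr0.
  by rewrite !multichains_bot strict_chains_bot subrr.
- move=> v w vL wL wv h IH n; rewrite (rank_step wL wv) iterSr.
  transitivity ((S n w)%:R : int).
    rewrite -IH; move: n.
    apply: eq_iter_backward_difference => -[|m]; first by rewrite /D subr0.
    by rewrite /D /= (sum_below_one _ vL wv h) natrD; ring.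
  by case: n => //= n; rewrite (sum_cells_one _ vL wv h).
move=> x y vL cP l0 l1 l2 IH0 IH1 IH2 n.
have r1 := rank_step l1 (ne_step_east x y.+1).
have r2 := rank_step l0 (ne_step_east x y).
have r0 := rank_step l0 (ne_step_north x y).
rewrite r1 r0 iterSr; rewrite r0 in IH1; rewrite r2 in IH2.
transitivity (iter (rank (x, y)).+2 D (fun n => (M n (x, y.+1))%:R +
     ((M n (x.+1, y))%:R + - (M n (x, y))%:R)) n).
  apply: eq_iter_backward_difference => -[|m]; first by rewrite /D subr0; ring.
  have /(congr1 (fun n => n%:R : int)) := sum_below_two (M m) vL.
  rewrite -!/(M m.+1 _) !natrD /D => h; apply: (addIr (M m.+1 (x, y))%:R).
  by rewrite addrAC h; ring.
rewrite !iter_backward_differenceD iter_backward_differenceN IH1 IH2 iterS {1}/D !IH0.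
case: n => [|n]; first by rewrite /=; ring.
have /(congr1 (fun n => n%:R : int)) := sum_cells_two (S n) cP.
rewrite -!/(S n.+1 _) !natrD => h; apply: (addIr (S n.+1 (x, y))%:R).
by rewrite h IH0; ring.
Qed.

End Counting.

(** * Switching classes of rooks *)

Lemma big_cons_tuple (R : Type) (idx : R) (op : Monoid.com_law idx)
    (T : finType) n (F : n.+1.-tuple T -> R) :
  \big[op/idx]_t F t =
  \big[op/idx]_(u : T) \big[op/idx]_(t : n.-tuple T) F [tuple of u :: t].
Proof.
rewrite pair_bigA (reindex (fun p : T * n.-tuple T => [tuple of p.1 :: p.2])) //=.
exists (fun t : n.+1.-tuple T => (thead t, [tuple of behead t])) => [[u t]|t] _.
  by congr pair; apply: val_inj.
by rewrite -tuple_eta.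
Qed.

(** Both [multichains] and [strict_chains] recurse on the largest element of the
    chain, which is the head of a decreasing tuple. *)
Lemma card_path_tuples (A : {fset point}) (r : rel point) (f : nat -> point -> nat) :
  (forall v, f 0 v = 1) ->
  (forall n v, f n.+1 v = \sum_(u : A | r v (fsval u)) f n (fsval u)) ->
  forall n v, #|[set t : n.-tuple A | path r v (map (@fsval _ A) t)]| = f n v.
Proof.
move=> f0 fS n; elim: n => [|n IH] v.
  rewrite f0 (_ : [set _ | _] = [set: 0.-tuple A]); last first.
    by apply/setP => t; rewrite !inE tuple0.
  by rewrite cardsT card_tuple expn0.
rewrite fS -sum1_card big_mkcond big_cons_tuple [RHS]big_mkcond.
apply: eq_bigr => u _; rewrite -IH -sum1_card [in RHS]big_mkcond /=.
case: ifP => vu; last by rewrite big1 // => t _; rewrite inE /= vu.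
by apply: eq_bigr => t _; rewrite !inE /= vu.
Qed.

Lemma eq_map_fst_snd (s s' : seq point) :
  map fst s = map fst s' -> map snd s = map snd s' -> s = s'.
Proof. by move=> h1 h2; rewrite -[s]zip_unzip -[s']zip_unzip /unzip1 /unzip2 h1 h2. Qed.

Lemma fset_eqE (A : {fset point}) (x y : A) : (x == y) = (fsval x == fsval y).
Proof. by []. Qed.

Lemma lt2_neq (u v : point) : lt2 u v || lt2 v u -> (u.1 != v.1) && (u.2 != v.2).
Proof. by rewrite /lt2; lia. Qed.

Lemma lt2_total (u v : point) : u.1 != v.1 -> u.2 != v.2 ->
  (v.1 < u.1 -> u.2 < v.2 -> False) -> (u.1 < v.1 -> v.2 < u.2 -> False) ->
  lt2 u v || lt2 v u.
Proof.
rewrite /lt2; case: (ltngtP u.1 v.1) => //; case: (ltngtP u.2 v.2) => //= _ _ _ _.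
  by move=> _ /(_ isT isT).
by move=> /(_ isT isT).
Qed.

Section Rooks.
Variables (P : {fset cell}) (o e : point).
Hypothesis PL : planar_lattice P o e.
Local Notation L := (vertices P).

Definition cols (F : {set P}) : seq nat := [seq (fsval c).1 | c in F].
Definition rows (F : {set P}) : seq nat := [seq (fsval c).2 | c in F].

Lemma nonattackingP (F : {set P}) :
  reflect ({in F &, injective (fun c : P => (fsval c).1)} /\
           {in F &, injective (fun c : P => (fsval c).2)}) (nonattacking F).
Proof.
apply: (iffP idP) => [|[inj1 inj2]].
  move=> /forall_inP h; split=> x y xF yF exy; apply/eqP;
    move: (h x xF) => /forall_inP/(_ y yF)/implyP; case: eqP => // _ /(_ isT);
    by rewrite exy eqxx ?andbF.
apply/forall_inP => x xF; apply/forall_inP => y yF; apply/implyP => nxy.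
by apply/andP; split; apply: contra nxy => /eqP exy; apply/eqP;
  [apply: inj1|apply: inj2].
Qed.

Lemma lines_replace (h : P -> nat) (D E F G : {set P}) :
  D \subset F -> G = (F :\: D) :|: E ->
  [seq h c | c in D] =i [seq h c | c in E] ->
  [seq h c | c in F] =i [seq h c | c in G].
Proof.
move=> DF -> DE i; apply/imageP/imageP => -[c cF ->].
  have [cD|cD] := boolP (c \in D); last by exists c => //; rewrite !inE cD cF.
  have /imageP[d dE ->] : h c \in [seq h c | c in E].
    by rewrite -DE; apply/imageP; exists c.
  by exists d => //; rewrite !inE dE orbT.
move: cF; rewrite !inE => /orP[/andP[_ cF]|cE]; first by exists c.
have /imageP[d dD ->] : h c \in [seq h c | c in D].
  by rewrite DE; apply/imageP; exists c.
by exists d => //; apply: (subsetP DF).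
Qed.

Lemma lines_corners (h : cell -> nat) (c d : cell) (D : {set P}) :
  c \in P -> d \in P -> (forall x, (x \in D) = (fsval x \in [:: c; d])) ->
  [seq h (fsval x) | x in D] =i [:: h c; h d].
Proof.
move=> cP dP hD i; rewrite !inE; apply/imageP/orP => [[x]|].
  by rewrite hD !inE => /orP[]/eqP-> ->; rewrite eqxx; [left|right].
by case=> /eqP->; [exists [` cP]%fset|exists [` dP]%fset];
  rewrite // hD !inE eqxx ?orbT.
Qed.

Lemma inner_interval_cell (a b : point) i j : inner_interval P a b ->
  a.1 <= i < b.1 -> a.2 <= j < b.2 -> (i, j) \in P.
Proof.
case/and3P=> _ _ /allP h hi hj; apply: h; apply/allpairsP; exists (i, j).
by rewrite !mem_index_iota.
Qed.

(** The diagonal and the antidiagonal cells of a rectangle occupy the same rows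
    and the same columns. *)
Lemma switch_lines F G : switch F G -> cols F =i cols G /\ rows F =i rows G.
Proof.
case/existsP=> a' /existsP[b'].
move: (\val a' : point) (\val b' : point) => [a1 a2] [b1 b2].
case/andP=> ab DE; have [/= ab1 ab2 _] := and3P ab.
have inP i j : a1 <= i < b1 -> a2 <= j < b2 -> (i, j) \in P.
  exact: (inner_interval_cell ab).
have c1 : (a1, a2) \in P by apply: inP; lia.
have c2 : (b1.-1, b2.-1) \in P by apply: inP; lia.
have c3 : (a1, b2.-1) \in P by apply: inP; lia.
have c4 : (b1.-1, a2) \in P by apply: inP; lia.
have hD x : (x \in diag_cells P (a1, a2) (b1, b2)) =
   (fsval x \in [:: (a1, a2); (b1.-1, b2.-1)]) by rewrite inE.
have hA x : (x \in anti_cells P (a1, a2) (b1, b2)) =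
   (fsval x \in [:: (a1, b2.-1); (b1.-1, a2)]) by rewrite inE.
have colsDA : cols (diag_cells P (a1, a2) (b1, b2)) =i
              cols (anti_cells P (a1, a2) (b1, b2)).
  by move=> i; rewrite (lines_corners fst c1 c2 hD) (lines_corners fst c3 c4 hA).
have rowsDA : rows (diag_cells P (a1, a2) (b1, b2)) =i
              rows (anti_cells P (a1, a2) (b1, b2)).
  move=> i; rewrite (lines_corners snd c1 c2 hD) (lines_corners snd c3 c4 hA).
  by rewrite !inE orbC.
case/orP: DE => /and3P[_ DF /eqP eG].
  by split; [apply: lines_replace DF eG colsDA|apply: lines_replace DF eG rowsDA].
by split; [apply: lines_replace DF eG (fun i => esym (colsDA i))
          |apply: lines_replace DF eG (fun i => esym (rowsDA i))].
Qed.

Lemma connect_lines F G : connect (@switch P) F G ->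
  cols F =i cols G /\ rows F =i rows G.
Proof.
case/connectP=> p; elim: p F => [|H p IH] F /=; first by move=> _ ->.
case/andP=> /switch_lines[h1 h2] /IH/[apply] -[h3 h4].
by split=> i; rewrite ?h1 ?h2.
Qed.

(** The rectangle spanned by two rooks in antidiagonal position lies in P, so the
    pair can be switched.  The sum of the products of the coordinates then strictly
    increases, by the product of the distances between the two columns and between
    the two rows; this is what makes the sorting process stop. *)
Lemma switch_to_diagonal (F : {set P}) (c d : P) :
  nonattacking F -> c \in F -> d \in F ->
  (fsval c).1 < (fsval d).1 -> (fsval d).2 < (fsval c).2 ->
  exists G : {set P}, [/\ nonattacking G, #|G| = #|F|, switch F G, switch G F &
    \sum_(x in F) (fsval x).1 * (fsval x).2 <
    \sum_(x in G) (fsval x).1 * (fsval x).2].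
Proof.
case: c d => -[i l] cP [[k j] dP] /= Fna cF dF ik jl.
have [v1 v2] : (i, l.+1) \in L /\ (k.+1, j) \in L.
  by move: (cP) (dP); rewrite !(pl_cell PL) => /andP[? _] /andP[_ ?].
have inP x y : i <= x <= k -> j <= y <= l -> (x, y) \in P.
  move=> hx hy; rewrite (pl_cell PL) /=.
  by apply/andP; split; apply: (pl_rect PL v1 v2); lia.
have aP : (i, j) \in P by apply: inP; lia.
have bP : (k, l) \in P by apply: inP; lia.
have aL : (i, j) \in L.
  by apply: (pl_rect PL v1 v2); rewrite leqnn /= ?(leqW (ltnW ik)) ?(leqW (ltnW jl)).
have bL : (k.+1, l.+1) \in L.
  by apply: (pl_rect PL v1 v2); rewrite leqnn andbT ?(leqW (ltnW ik)) ?(leqW (ltnW jl)).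
pose c : P := [` cP]%fset; pose d : P := [` dP]%fset.
pose a : P := [` aP]%fset; pose b : P := [` bP]%fset.
have [/nonattackingP[inj1 inj2]] := Fna.
pose R := F :\ c :\ d.
have hR z : z \in R -> [/\ z \in F, (fsval z).1 != i, (fsval z).1 != k,
                          (fsval z).2 != j & (fsval z).2 != l].
  rewrite !inE => /and3P[zd zc zF].
  have n1 := contra_neq (inj1 z c zF cF) zc; have n2 := contra_neq (inj1 z d zF dF) zd.
  have n3 := contra_neq (inj2 z c zF cF) zc; have n4 := contra_neq (inj2 z d zF dF) zd.
  by [].
have cd : c != d by rewrite fset_eqE /= xpair_eqE (ltn_eqF ik).
have ab : a != b by rewrite fset_eqE /= xpair_eqE (ltn_eqF ik).
have ac : a != c by rewrite fset_eqE /= xpair_eqE (ltn_eqF jl) andbF.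
have ad : a != d by rewrite fset_eqE /= xpair_eqE (ltn_eqF ik).
have bc : b != c by rewrite fset_eqE /= xpair_eqE (gtn_eqF ik).
have bd : b != d by rewrite fset_eqE /= xpair_eqE (gtn_eqF jl) andbF.
have aR : a \notin R by apply/negP => /hR[_]; rewrite /= eqxx.
have bR : b \notin R by apply/negP => /hR[_ _]; rewrite /= eqxx.
have cR : c \notin R by rewrite !inE eqxx andbF.
have dR : d \notin R by rewrite !inE eqxx.
have eF : F = c |: (d |: R).
  by rewrite setD1K ?setD1K // !inE dF eq_sym cd.
have aF : a \notin F by apply: contraNN ac => aF; apply/eqP; apply: inj1.
have bF : b \notin F by apply: contraNN bd => bF; apply/eqP; apply: inj1.
have eA : anti_cells P (i, j) (k.+1, l.+1) = [set c; d].
  by apply/setP => x; rewrite !inE !fset_eqE.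
have eD : diag_cells P (i, j) (k.+1, l.+1) = [set a; b].
  by apply/setP => x; rewrite !inE !fset_eqE.
have inner : inner_interval P (i, j) (k.+1, l.+1).
  rewrite /inner_interval /= ltnS (ltnW ik) ltnS (ltnW jl) /=.
  apply/allP => _ /allpairsP[[x y] /= [hx hy ->]].
  by move: hx hy; rewrite !mem_index_iota !ltnS; apply: inP.
exists (a |: (b |: R)); split.
- apply/nonattackingP; split=> x y; rewrite !in_setU1.
    move=> /or3P[/eqP->|/eqP->|/hR[xF x1 x2 x3 x4]]
      /or3P[/eqP->|/eqP->|/hR[yF y1 y2 y3 y4]] //= h;
      by [exact: inj1|rewrite h ltnn in ik|rewrite h eqxx in x1|rewrite h eqxx in x2
         |rewrite -h eqxx in y1|rewrite -h eqxx in y2].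
  move=> /or3P[/eqP->|/eqP->|/hR[xF x1 x2 x3 x4]]
      /or3P[/eqP->|/eqP->|/hR[yF y1 y2 y3 y4]] //= h;
      by [exact: inj2|rewrite h ltnn in jl|rewrite h eqxx in x3|rewrite h eqxx in x4
         |rewrite -h eqxx in y3|rewrite -h eqxx in y4].
- by rewrite [in RHS]eF !cardsU1 !in_setU1 (negPf aR) (negPf bR) (negPf cR) (negPf dR)
    (negPf ab) (negPf cd).
- apply/existsP; exists [` aL]%fset; apply/existsP; exists [` bL]%fset.
  rewrite /= inner eA eD /replace !cards2 ab cd /=; apply/orP; right.
  apply/andP; split; first by apply/subsetP => x /set2P[]->.
  apply/eqP/setP => x; rewrite in_setU in_setD !in_set2 !in_setU1 !inE.
  by case: (x == a) (x == b) (x == c) (x == d) (x \in F) => [] [] [] [] [].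
- apply/existsP; exists [` aL]%fset; apply/existsP; exists [` bL]%fset.
  rewrite /= inner eA eD /replace !cards2 ab cd /=; apply/orP; left.
  apply/andP; split; first by apply/subsetP => x; rewrite in_set2 !in_setU1 orbA => ->.
  apply/eqP/setP => x; rewrite in_setU in_setD !in_set2 !in_setU1 !inE.
  have [->|_] := eqVneq x a; first by rewrite (negPf aF) (negPf ac) (negPf ad).
  have [->|_] := eqVneq x b; first by rewrite (negPf bF) (negPf bc) (negPf bd) orbT.
  have [->|_] := eqVneq x c; first by rewrite cF orbT.
  have [->|_] := eqVneq x d; first by rewrite dF orbT.
  by rewrite /= orbF; case: (x \in F).
rewrite [in X in X < _]eF !big_setU1 ?in_setU1 ?negb_or ?aR ?bR ?cR ?dR ?ab ?cd //=.
clear - ik jl; nia.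
Qed.

Definition gt2 (u v : point) : bool := lt2 v u.

Lemma gt2_trans : transitive gt2.
Proof. by move=> v u w; rewrite /gt2 /lt2; lia. Qed.

Lemma gt2_irr : irreflexive gt2.
Proof. by move=> v; rewrite /gt2 /lt2 ltnn. Qed.

Definition rook_chains k : {set k.-tuple P} :=
  [set t : k.-tuple P | path gt2 e (map (@fsval _ P) t)].

Lemma card_rook_chains k : #|rook_chains k| = strict_chains P k e.
Proof. exact: card_path_tuples. Qed.

Lemma below_top (c : P) : gt2 e (fsval c).
Proof.
have /(pl_bounds PL) := upper_right_vertex (fsvalP c).
by rewrite /gt2 /lt2 /leq2 /=; lia.
Qed.

Lemma mem_rook_chains k (t : k.-tuple P) :
  (t \in rook_chains k) = sorted gt2 (map (@fsval _ P) t).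
Proof.
by rewrite inE path_min_sorted // all_map; apply/allP => c _; apply: below_top.
Qed.

Lemma rook_chain_rooks k (t : k.-tuple P) :
  t \in rook_chains k -> [set x in t] \in rooks P k.
Proof.
rewrite mem_rook_chains => ts.
have ut : uniq t by rewrite -(map_inj_uniq val_inj) (sorted_uniq gt2_trans gt2_irr).
rewrite inE cardsE (card_uniqP ut) size_tuple eqxx andbT.
have pw : forall x y, x \in t -> y \in t -> x != y ->
    lt2 (fsval x) (fsval y) || lt2 (fsval y) (fsval x).
  move=> x y /(nthP x)[i it <-] /(nthP x)[j jt <-].
  rewrite nth_uniq // neq_ltn => ij.
  have := sorted_ltn_nth gt2_trans (fsval x) ts; rewrite size_map => h.
  case/orP: ij => ij; apply/orP; [right|left].
    by have := h i j it jt ij; rewrite !(nth_map x) // /gt2.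
  by have := h j i jt it ij; rewrite !(nth_map x) // /gt2.
apply/forall_inP => x; rewrite inE => xt; apply/forall_inP => y; rewrite inE => yt.
by apply/implyP => /(pw _ _ xt yt); apply: lt2_neq.
Qed.

(** A chain is recovered by sorting its columns and its rows separately. *)
Lemma rook_chain_inj k (t t' : k.-tuple P) :
  t \in rook_chains k -> t' \in rook_chains k ->
  cols [set x in t] =i cols [set x in t'] ->
  rows [set x in t] =i rows [set x in t'] -> t = t'.
Proof.
rewrite !mem_rook_chains => ts ts' hc hr.
have srt (h : point -> nat) (s : k.-tuple P) :
    (forall u v, gt2 u v -> h v < h u) -> sorted gt2 (map (@fsval _ P) s) ->
    sorted gtn (map h (map (@fsval _ P) s)).
  by move=> hh; rewrite sorted_map; apply: sub_sorted => u v; apply: hh.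
have mm (h : point -> nat) (s s' : k.-tuple P) :
    [seq h (fsval x) | x in [set x in s]] =i [seq h (fsval x) | x in [set x in s']] ->
    map h (map (@fsval _ P) s) =i map h (map (@fsval _ P) s').
  have aux (s0 : k.-tuple P) i : (i \in map h (map (@fsval _ P) s0)) =
      (i \in [seq h (fsval x) | x in [set x in s0]]).
    rewrite -map_comp; apply/mapP/imageP => -[x xs ->]; exists x => //;
    by move: xs; rewrite inE.
  by move=> hs i; rewrite !aux hs.
apply/val_inj/(inj_map val_inj)/eq_map_fst_snd.
  apply: (irr_sorted_eq (rev_trans ltn_trans) ltnn); [| |exact: mm hc].
    by apply: srt ts => u v /andP[].
  by apply: srt ts' => u v /andP[].
apply: (irr_sorted_eq (rev_trans ltn_trans) ltnn); [| |exact: mm hr].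
  by apply: srt ts => u v /andP[].
by apply: srt ts' => u v /andP[].
Qed.

(** Among the configurations linked to F in both directions, one of maximal weight
    has no pair in antidiagonal position, by [switch_to_diagonal]. *)
Lemma connect_rook_chain k (F : {set P}) : F \in rooks P k ->
  exists2 t : k.-tuple P, t \in rook_chains k &
    connect (@switch P) F [set x in t] /\ connect (@switch P) [set x in t] F.
Proof.
move=> FR; pose C := [pred G | [&& G \in rooks P k, connect (@switch P) F G &
                                connect (@switch P) G F]].
have CF : C F by rewrite /C /= FR !connect0.
pose wt (G : {set P}) := \sum_(x in G) (fsval x).1 * (fsval x).2.
case: (arg_maxnP wt CF) => G /and3P[GR FG GF] Gmax.
have /andP[Gna /eqP Gk] : nonattacking G && (#|G| == k) by move: GR; rewrite inE.
have comp x y : x \in G -> y \in G -> (x == y) || lt2 (fsval x) (fsval y)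
    || lt2 (fsval y) (fsval x).
  move=> xG yG; have [//|nxy] /= := eqVneq x y.
  have [inj1 inj2] := nonattackingP _ Gna.
  have n1 := contra_neq (inj1 x y xG yG) nxy.
  have n2 := contra_neq (inj2 x y xG yG) nxy.
  have noswitch u v : u \in G -> v \in G -> (fsval u).1 < (fsval v).1 ->
      (fsval v).2 < (fsval u).2 -> False.
    move=> uG vG uv1 uv2.
    have [H [Hna Hk GH HG lt]] := switch_to_diagonal Gna uG vG uv1 uv2.
    have : C H.
      rewrite /C /= inE Hna Hk Gk eqxx /=.
      by rewrite (connect_trans FG (connect1 GH)) (connect_trans (connect1 HG) GF).
    by move/Gmax => /(leq_trans lt); rewrite ltnn.
  have := noswitch x y xG yG; have := noswitch y x yG xG.
  exact: lt2_total.
pose le (x y : P) := (x == y) || gt2 (fsval x) (fsval y).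
pose s := sort le (enum G).
have ss : sorted le s.
  apply: (@sort_sorted_in _ (mem G)); last by apply/allP => x; rewrite mem_enum.
  move=> x y xG yG; rewrite /le /gt2; move: (comp x y xG yG).
  by rewrite (eq_sym y x); case: (x == y) => //=; rewrite orbC.
have sz : size s == k by rewrite size_sort -cardE Gk.
have us : uniq s by rewrite sort_uniq enum_uniq.
have es : [set x in Tuple sz] = G.
  by apply/setP => x; rewrite inE /= mem_sort mem_enum.
exists (Tuple sz); last by rewrite es.
rewrite mem_rook_chains sorted_map -[tval _]/s.
case: s ss us {sz es} => // x0 s /(sortedP x0) ss us.
apply/(sortedP x0) => i ilt; have := ss i ilt.
by rewrite /le nth_uniq // ?(ltnW ilt) // ltn_eqF.
Qed.

Theorem card_rook_classes k : #|rook_classes P k| = strict_chains P k e.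
Proof.
rewrite -card_rook_chains.
pose cls (F : {set P}) := [set G in rooks P k | connect (@switch P) F G].
rewrite (_ : rook_classes P k =
  [set cls [set x in (t : k.-tuple P)] | t in rook_chains k]).
  apply: card_in_imset => t t' tT t'T /= et.
  have : [set x in t'] \in cls [set x in t].
    by rewrite et inE connect0 rook_chain_rooks.
  by rewrite inE => /andP[_ /connect_lines[]]; apply: rook_chain_inj.
apply/setP => A; apply/imsetP/imsetP => -[].
  move=> F FR ->; have [t tT [Ft tF]] := connect_rook_chain FR.
  exists t => //; apply/setP => G; rewrite !inE; congr (_ && _).
  by apply/idP/idP => [|]; apply: connect_trans.
move=> t tT ->; exists [set x in t]; first exact: rook_chain_rooks.
by apply/setP => G; rewrite !inE.
Qed.

Theorem coef_switching_rook_poly k :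
  ((switching_rook_poly P)`_k = (strict_chains P k e)%:R :> int)%R.
Proof.
rewrite /switching_rook_poly -card_rook_classes coef_sum.
under eq_bigr do rewrite coefZ coefXn.
have [kr|rk] := ltnP k (rook_number P).+1.
  rewrite (bigD1 (Ordinal kr)) //= eqxx mulr1 big1 ?addr0 // => i ik.
  by rewrite -val_eqE /= eq_sym in ik; rewrite (negPf ik) mulr0.
rewrite big1 => [|i _]; last first.
  by rewrite gtn_eqF ?mulr0 // (leq_trans (ltn_ord i)).
suff -> : rook_classes P k = set0 by rewrite cards0.
suff R0 : rooks P k = set0.
  by apply/setP => A; rewrite inE; apply/imsetP => -[F]; rewrite R0 inE.
apply/eqP; apply: contraLR rk => Rn0; rewrite -leqNgt.
have kP : k < #|{: P}|.+1.
  have /set0Pn[F] := Rn0; rewrite inE => /andP[_ /eqP <-].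
  by rewrite ltnS max_card.
exact: (leq_bigmax_cond (Ordinal kP)).
Qed.

End Rooks.

(** * Linear algebra *)

Section LinearAlgebra.
Local Open Scope ring_scope.
Variables (K : fieldType) (V : lmodType K).

Definition in_span (T : finType) (g : T -> V) (v : V) : Prop :=
  exists c : T -> K, v = \sum_t c t *: g t.

Lemma in_span_gen (T : finType) (g : T -> V) t : in_span g (g t).
Proof.
exists (fun t' => (t' == t)%:R).
rewrite (bigD1 t) //= eqxx scale1r big1 ?addr0 // => t' nt.
by rewrite (negPf nt) scale0r.
Qed.

Lemma in_span0 (T : finType) (g : T -> V) : in_span g 0.
Proof. by exists (fun=> 0); rewrite big1 // => t _; rewrite scale0r. Qed.

Lemma in_spanDZ (T : finType) (g : T -> V) a u v :
  in_span g u -> in_span g v -> in_span g (a *: u + v).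
Proof.
move=> [c ->] [d ->]; exists (fun t => a * c t + d t).
by rewrite scaler_sumr -big_split; apply: eq_bigr => t _; rewrite scalerDl scalerA.
Qed.

Lemma in_span_sum (T : finType) (g : T -> V) (I : eqType) (s : seq I)
    (c : I -> K) (f : I -> V) :
  (forall i, i \in s -> in_span g (f i)) -> in_span g (\sum_(i <- s) c i *: f i).
Proof.
elim: s => [|i s IH] h; first by rewrite big_nil; apply: in_span0.
rewrite big_cons; apply: in_spanDZ; first by apply: h; rewrite inE eqxx.
by apply: IH => j js; apply: h; rewrite inE js orbT.
Qed.

(** The Steinitz bound: with fewer generators than vectors, the coordinate matrix
    has a nonzero left kernel, which is a linear relation between the vectors. *)
Lemma free_card_le (S T : finType) (b : S -> V) (g : T -> V) :
  (forall c : S -> K, \sum_s c s *: b s = 0 -> forall s, c s = 0) ->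
  (forall s, in_span g (b s)) -> (#|S| <= #|T|)%N.
Proof.
move=> free /choice[A bA].
pose M := \matrix_(i < #|S|, j < #|T|) A (enum_val i) (enum_val j).
rewrite leqNgt; apply/negP => TS.
have : kermx M != 0.
  by rewrite kermx_eq0 -row_leq_rank -ltnNge (leq_ltn_trans (rank_leq_col M)).
case/rowV0Pn => w /sub_kermxP wM /eqP; apply; apply/rowP => i; rewrite mxE.
rewrite -(enum_valK i); apply: (free (fun s => w 0 (enum_rank s))).
under eq_bigr do rewrite bA scaler_sumr.
rewrite exchange_big big1 //= => t _.
under eq_bigr do rewrite scalerA.
rewrite -scaler_suml (_ : \sum_s _ = 0) ?scale0r //.
transitivity ((w *m M) 0 (enum_rank t)); last by rewrite wM mxE.
rewrite mxE.
rewrite (reindex (@enum_val S predT)) /=.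
  by apply: eq_bigr => j _; rewrite mxE enum_valK enum_rankK.
exact: onW_bij (enum_val_bij _).
Qed.

End LinearAlgebra.

Lemma has_dim_uniq (K : fieldType) (V : lmodType K) (W : V -> Prop) m n :
  has_dim W m -> has_dim W n -> m = n.
Proof.
have le a b : has_dim W a -> has_dim W b -> a <= b.
  move=> [f [Wf free _]] [g [_ _ span]].
  rewrite -(card_ord a) -(card_ord b); apply: (free_card_le free) => s.
  exact: span.
by move=> hm hn; apply/eqP; rewrite eqn_leq !le.
Qed.

(** * The Hilbert function of the coordinate ring *)

Lemma pl_meet P o e (u v : point) : planar_lattice P o e ->
  u \in vertices P -> v \in vertices P ->
  (minn u.1 v.1, minn u.2 v.2) \in vertices P.
Proof.
case: u v => [i j] [k l] /= PL uL vL.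
have [ik|ki] := leqP i k; have [jl|lj] := leqP j l => //.
  by apply: (pl_rect PL uL vL); lia.
by apply: (pl_rect PL vL uL); lia.
Qed.

Lemma pl_join P o e (u v : point) : planar_lattice P o e ->
  u \in vertices P -> v \in vertices P ->
  (maxn u.1 v.1, maxn u.2 v.2) \in vertices P.
Proof.
case: u v => [i j] [k l] /= PL uL vL.
have [ik|ki] := leqP i k; have [jl|lj] := leqP j l => //.
  by apply: (pl_rect PL uL vL); lia.
by apply: (pl_rect PL vL uL); lia.
Qed.

Section CoordinateRing.
Variables (K : fieldType) (P : {fset cell}) (o e : point).
Hypothesis PL : planar_lattice P o e.
Local Notation L := (vertices P).
Local Notation N := #|{: L}|.
Local Notation A := (coord_ring K P).
Local Notation pi := (@to_coord_ring K P).

Local Open Scope ring_scope.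

Lemma to_coord_ring_is_zmod_morphism : zmod_morphism pi.
Proof. by move=> f g; rewrite /to_coord_ring rmorphB. Qed.

Lemma to_coord_ring_is_monoid_morphism : monoid_morphism pi.
Proof.
by split=> [|f g]; rewrite /to_coord_ring ?rmorph1 ?rmorphM.
Qed.

HB.instance Definition _ := GRing.isZmodMorphism.Build _ _ pi
  to_coord_ring_is_zmod_morphism.
HB.instance Definition _ := GRing.isMonoidMorphism.Build _ _ pi
  to_coord_ring_is_monoid_morphism.

Lemma to_coord_ringZ c f : pi (c *: f) = c *: pi f.
Proof. by rewrite -mul_mpolyC rmorphM. Qed.

Lemma coord_scaleE c (x : A) : c *: x = pi c%:MP * x. Proof. by []. Qed.

Lemma to_coord_ring_eq f g : (pi f = pi g) <-> (f - g \in @polyomino_ideal K P).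
Proof.
split=> [|h]; first by move=> /eqP; rewrite /to_coord_ring -Quotient.idealrBE.
by apply/eqP; rewrite /to_coord_ring -Quotient.idealrBE.
Qed.

Lemma to_coord_ring_surj (x : A) : exists f, x = pi f.
Proof. by exists (repr x); rewrite /to_coord_ring reprK. Qed.

Definition vertex_monomial (s : seq L) : A := pi (\prod_(v <- s) xvar K v).

Lemma vertex_monomial_cons v s :
  vertex_monomial (v :: s) = pi (xvar K v) * vertex_monomial s.
Proof. by rewrite /vertex_monomial big_cons rmorphM. Qed.

Lemma vertex_monomial_cat s t :
  vertex_monomial (s ++ t) = vertex_monomial s * vertex_monomial t.
Proof. by rewrite /vertex_monomial big_cat rmorphM. Qed.

Local Close Scope ring_scope.

Lemma inner_interval_corners (a b : point) : a.1 < b.1 -> a.2 < b.2 ->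
  (a.1, b.2) \in L -> (b.1, a.2) \in L -> inner_interval P a b.
Proof.
case: a b => [i j] [k l] /= ik jl cL dL; rewrite /inner_interval /= ik jl /=.
apply/allP => _ /allpairsP[[x y] /= [hx hy ->]].
move: hx hy; rewrite !mem_index_iota => hx hy.
by rewrite (pl_cell PL) /=; apply/andP; split; apply: (pl_rect PL cL dL); lia.
Qed.

(** This is one of the generators of the ideal, read in the quotient. *)
Lemma exchange_corners (u v a b : L) :
  (fsval u).1 < (fsval v).1 -> (fsval v).2 < (fsval u).2 ->
  fsval a = ((fsval u).1, (fsval v).2) -> fsval b = ((fsval v).1, (fsval u).2) ->
  (pi (xvar K u) * pi (xvar K v) = pi (xvar K a) * pi (xvar K b))%R.
Proof.
move=> uv1 vu2 ea eb; rewrite -!rmorphM; symmetry.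
apply/to_coord_ring_eq/asboolP.
exists [:: (1, xvar K a * xvar K b - xvar K u * xvar K v)%R].
split=> [p|]; last by rewrite big_seq1 mul1r.
rewrite inE => /eqP-> /=; exists a, b, u, v; split=> //.
- apply: inner_interval_corners; rewrite /= ?ea ?eb //=.
    by move: (fsvalP u); case: (fsval u).
  by move: (fsvalP v); case: (fsval v).
- by rewrite /= ea eb; case: (fsval u).
by rewrite /= ea eb; case: (fsval v).
Qed.

Lemma straighten_pair (u v : L) : exists a b : L,
  [/\ fsval a = (minn (fsval u).1 (fsval v).1, minn (fsval u).2 (fsval v).2),
      fsval b = (maxn (fsval u).1 (fsval v).1, maxn (fsval u).2 (fsval v).2) &
      (pi (xvar K u) * pi (xvar K v) = pi (xvar K a) * pi (xvar K b))%R].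
Proof.
have aL := pl_meet PL (fsvalP u) (fsvalP v).
have bL := pl_join PL (fsvalP u) (fsvalP v).
have [uv1|vu1] := leqP (fsval u).1 (fsval v).1;
  have [uv2|vu2] := leqP (fsval u).2 (fsval v).2.
- by exists u, v; split=> //; [case: (fsval u)|case: (fsval v)].
- have [e1|n1] := eqVneq (fsval u).1 (fsval v).1.
    exists v, u; split; last by rewrite mulrC.
      by rewrite e1; case: (fsval v).
    by rewrite -e1; case: (fsval u).
  rewrite (minn_idPl uv1) (minn_idPr (ltnW vu2)) in aL.
  rewrite (maxn_idPr uv1) (maxn_idPl (ltnW vu2)) in bL.
  exists [` aL]%fset, [` bL]%fset; split=> //.
  by apply: exchange_corners => //=; rewrite ltn_neqAle n1.
- have [e2|n2] := eqVneq (fsval u).2 (fsval v).2.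
    exists v, u; split; last by rewrite mulrC.
      by rewrite e2; case: (fsval v).
    by rewrite -e2; case: (fsval u).
  rewrite (minn_idPr (ltnW vu1)) (minn_idPl uv2) in aL.
  rewrite (maxn_idPl (ltnW vu1)) (maxn_idPr uv2) in bL.
  exists [` aL]%fset, [` bL]%fset; split=> //; rewrite mulrC.
  by apply: exchange_corners => //=; rewrite ltn_neqAle n2.
by exists v, u; split; rewrite 1?mulrC //; [case: (fsval v)|case: (fsval u)].
Qed.

Definition geq2 (u v : point) : bool := leq2 v u.

Lemma geq2_trans : transitive geq2.
Proof. by move=> v u w; rewrite /geq2 /leq2; lia. Qed.

(** Insertion sort: replacing x, y by their minimum a and maximum b puts b in front
    of everything else, and a is then inserted in the tail.  The last clause
    records that upper bounds are preserved, which keeps b in front. *)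
Lemma insert_vertex (s : seq L) (x : L) : sorted geq2 (map (@fsval _ L) s) ->
  exists t : seq L, [/\ size t = (size s).+1, sorted geq2 (map (@fsval _ L) t),
    vertex_monomial (x :: s) = vertex_monomial t &
    forall z : point, geq2 z (fsval x) -> all (fun y : L => geq2 z (fsval y)) s ->
      all (fun y : L => geq2 z (fsval y)) t].
Proof.
elim: s x => [|y s IH] x ss; first by exists [:: x]; split=> //= z ->.
have [a [b [ea eb exy]]] := straighten_pair x y.
have ss' : sorted geq2 (map (@fsval _ L) s) by apply: path_sorted ss.
have [t [szt st et bt]] := IH a ss'.
have ys : all (fun u : L => geq2 (fsval y) (fsval u)) s.
  by rewrite -(all_map (@fsval _ L) (geq2 (fsval y))); exact: order_path_min geq2_trans ss.
have by_ : geq2 (fsval b) (fsval y) by rewrite /geq2 /leq2 eb /= !leq_maxr.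
have ba : geq2 (fsval b) (fsval a).
  by rewrite /geq2 /leq2 ea eb /= !geq_min !leq_max !leqnn.
exists (b :: t); split=> /=.
- by rewrite szt.
- rewrite path_min_sorted // all_map; apply: bt => //.
  by apply: sub_all ys => u; apply: geq2_trans.
- by rewrite !vertex_monomial_cons -et vertex_monomial_cons !mulrA exy; congr (_ * _)%R; rewrite mulrC.
move=> z zx /andP[zy zs]; apply/andP; split.
  by move: zx zy; rewrite /geq2 /leq2 eb /= !geq_max => /andP[-> ->].
apply: bt => //; apply: (geq2_trans zx).
by rewrite /geq2 /leq2 ea /= !geq_minl.
Qed.

Lemma straighten (s : seq L) : exists t : seq L,
  [/\ size t = size s, sorted geq2 (map (@fsval _ L) t) &
      vertex_monomial s = vertex_monomial t].
Proof.
elim: s => [|x s [t [szt st et]]]; first by exists [::].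
have [t' [szt' st' et' _]] := insert_vertex x st.
exists t'; split=> //; first by rewrite szt' szt.
by rewrite -et' !vertex_monomial_cons et.
Qed.

Definition vertex_chains k : {set k.-tuple L} :=
  [set t : k.-tuple L | path geq2 e (map (@fsval _ L) t)].

Lemma card_vertex_chains k : #|vertex_chains k| = multichains P k e.
Proof. exact: card_path_tuples. Qed.

Lemma mem_vertex_chains k (t : k.-tuple L) :
  (t \in vertex_chains k) = sorted geq2 (map (@fsval _ L) t).
Proof.
rewrite inE path_min_sorted // all_map; apply/allP => c _ /=.
by have /andP[] := pl_bounds PL (fsvalP c).
Qed.

Lemma straighten_chain (s : seq L) : exists2 t : (size s).-tuple L,
  t \in vertex_chains (size s) & vertex_monomial s = vertex_monomial t.
Proof.
have [t [/eqP szt st ->]] := straighten s.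
by exists (Tuple szt); rewrite ?mem_vertex_chains.
Qed.

Local Open Scope ring_scope.

Lemma mpolyX_vertices (m : 'X_{1..N}) : exists s : seq L,
  size s = mdeg m /\ 'X_[m] = \prod_(v <- s) xvar K v.
Proof.
exists (map enum_val (m2s m)); split; first by rewrite size_map size_m2s.
rewrite big_map -{1}[m]s2mK /xvar.
under eq_bigr do rewrite enum_valK.
rewrite -(big_map (fun i => U_(i)%MM) predT (fun m => 'X_[m])) mpolyX_prod big_map.
congr 'X_[_]; apply/mnmP => i.
rewrite mnm_sumE mnmE -sum1_count big_mkcond; apply: eq_bigr => j _.
by rewrite mnm1E /=; case: (j == i).
Qed.

Lemma to_coord_ringE (f : {mpoly K[N]}) :
  pi f = \sum_(m <- msupp f) f@_m *: pi 'X_[m].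
Proof.
by rewrite {1}[f]mpolyE raddf_sum; apply: eq_bigr => m _; exact: to_coord_ringZ.
Qed.

Lemma vertex_monomial_homog (s : seq L) :
  \prod_(v <- s) xvar K v \is (size s).-homog.
Proof.
elim: s => [|v s IH]; first by rewrite big_nil /= dhomog1.
by rewrite big_cons /= -add1n dhomogM // dhomogX /= mdeg1.
Qed.

Lemma graded_piece_span k (x : A) : @graded_piece K P k x ->
  in_span (fun t : 'I_#|vertex_chains k| => vertex_monomial (enum_val t)) x.
Proof.
case=> f fk ->; rewrite to_coord_ringE; apply: in_span_sum => m mf.
have [s [sz ->]] := mpolyX_vertices m.
have sk : size s = k by rewrite sz; exact: (dhomog_mf fk).
have [t tC et] := straighten_chain s; rewrite -/(vertex_monomial s) et.
move: t tC {et}; rewrite sk => t tC.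
have := in_span_gen (fun t : 'I_#|vertex_chains k| => vertex_monomial (enum_val t))
  (enum_rank_in tC t).
by rewrite enum_rankK_in.
Qed.

Definition coord_bound : nat := maxn e.1 e.2.
Local Notation B := coord_bound.
Local Notation T := {mpoly K[B.+1 + B.+1]}.

Lemma vertex_bounds (u : L) : ((fsval u).1 < B.+1)%N /\ ((fsval u).2 < B.+1)%N.
Proof.
have /andP[_] := pl_bounds PL (fsvalP u); rewrite /leq2 => /andP[h1 h2].
by rewrite !ltnS /coord_bound !leq_max h1 h2 orbT.
Qed.

Definition toric_exponent (u : point) : 'X_{1..B.+1 + B.+1} :=
  (U_(lshift _ (inord u.1)) + U_(rshift _ (inord u.2)))%MM.

(** The face of the toric ring above v: variables of vertices that are not above v
    are sent to zero. *)
Definition face_var (v : point) (i : 'I_N) : T :=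
  let u := fsval (enum_val i) in
  if leq2 v u then 'X_[toric_exponent u] else 0.

Definition face_map (v : point) : {mpoly K[N]} -> T :=
  mmap (@mpolyC _ K) (face_var v).

HB.instance Definition _ v := GRing.RMorphism.on (face_map v).

Lemma face_map_xvar v (u : L) : face_map v (xvar K u) =
  if leq2 v (fsval u) then 'X_[toric_exponent (fsval u)] else 0.
Proof. by rewrite /face_map mmapX mmap1U /face_var enum_rankK. Qed.

(** In each generator the two monomials use the same rows and the same columns, so
    they have the same toric image and one avoids the killed lines exactly when the
    other does. *)
Lemma face_map_ideal v f : f \in @polyomino_ideal K P -> face_map v f = 0.
Proof.
move=> /asboolP[s [sG ->]]; rewrite rmorph_sum big1_seq // => p /= /sG.
case=> a [b [c [d [/and3P[/ltnW ab1 /ltnW ab2 _] ec ed ->]]]].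
rewrite rmorphM rmorphB !rmorphM /= !face_map_xvar.
move: ec ed ab1 ab2 => /= -> ->.
move: (fsval a : point) (fsval b : point) => [a1 a2] [b1 b2] /= ab1 ab2.
rewrite (_ : _ - _ = 0) ?mulr0 //; apply/eqP; rewrite subr_eq0; apply/eqP.
have h : leq2 v (a1, a2) && leq2 v (b1, b2) = leq2 v (a1, b2) && leq2 v (b1, a2).
  by rewrite /leq2 /=; lia.
have ifM (p1 p2 : bool) (x y : T) :
    (if p1 then x else 0) * (if p2 then y else 0) = if p1 && p2 then x * y else 0.
  by case: p1; case: p2; rewrite ?mulr0 ?mul0r.
rewrite !ifM h -!mpolyXD /toric_exponent /=; case: ifP => // _.
by congr 'X_[_]; apply/mnmP => i; rewrite !mnmDE; lia.
Qed.

Definition face_ideal (v : point) : {pred A} :=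
  fun x => face_map v (repr x) == 0.

Lemma mem_face_ideal v f : (pi f \in face_ideal v) = (face_map v f == 0).
Proof.
rewrite unfold_in /face_ideal.
have : pi f = pi (repr (pi f)) by rewrite /to_coord_ring reprK.
move=> /to_coord_ring_eq/(face_map_ideal v) /eqP.
by rewrite rmorphB subr_eq0 => /eqP->.
Qed.

Lemma face_ideal_prime v : prime_ideal (face_ideal v).
Proof.
split; [split|].
- by rewrite -(rmorph0 pi) mem_face_ideal rmorph0.
- by rewrite -(rmorph1 pi) mem_face_ideal rmorph1 oner_eq0.
- move=> a x y; have [f ->] := to_coord_ring_surj a.
  have [g ->] := to_coord_ring_surj x; have [h ->] := to_coord_ring_surj y.
  rewrite -rmorphM -rmorphD !mem_face_ideal rmorphD rmorphM /=.
  by move=> /eqP-> /eqP->; rewrite mulr0 addr0.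
move=> x y; have [f ->] := to_coord_ring_surj x.
have [g ->] := to_coord_ring_surj y.
by rewrite -rmorphM !mem_face_ideal rmorphM mulf_eq0.
Qed.

Definition kill_map (v : point) : T -> T :=
  mmap (@mpolyC _ K) (fun i => match split i with
    | inl j => if (v.1 <= j)%N then 'X_i else 0
    | inr j => if (v.2 <= j)%N then 'X_i else 0 end).

HB.instance Definition _ v := GRing.RMorphism.on (kill_map v).

(** Killing more lines factors through killing fewer, so the face ideals
    increase with v. *)
Lemma kill_face_map v w f : leq2 v w -> face_map w f = kill_map w (face_map v f).
Proof.
move=> vw; rewrite /face_map /mmap rmorph_sum; apply: eq_bigr => m _.
rewrite rmorphM /= /mmap1 rmorph_prod /= {1}/kill_map mmapC; congr (_ * _).
apply: eq_bigr => i _; rewrite rmorphXn; congr (_ ^+ _).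
rewrite /face_var; have [b1 b2] := vertex_bounds (enum_val i).
move: (fsval (enum_val i)) b1 b2 => [x y] /= b1 b2.
have [vu|vu] := boolP (leq2 v (x, y)); last first.
  rewrite rmorph0 ifF //; apply: contraNF vu; move: vw.
  by rewrite /leq2 /=; lia.
rewrite /toric_exponent mpolyXD rmorphM /= /kill_map !mmapX !mmap1U.
rewrite (unsplitK (inl _)) (unsplitK (inr _)) !inordK // /leq2 /=.
by case: (w.1 <= x)%N; case: (w.2 <= y)%N; rewrite /= ?mulr0 ?mul0r.
Qed.

Lemma face_ideal_sub v w : leq2 v w -> {subset face_ideal v <= face_ideal w}.
Proof.
move=> vw x; have [f ->] := to_coord_ring_surj x.
suff : pi f \in face_ideal v -> pi f \in face_ideal w by [].
rewrite !mem_face_ideal => /eqP f0.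
have k0 : kill_map w 0 = 0 by exact: raddf0.
by rewrite (kill_face_map f vw) f0 k0.
Qed.

Definition toric_weight (s : seq L) : 'X_{1..B.+1 + B.+1} :=
  (\sum_(u <- s) toric_exponent (fsval u))%MM.

Lemma face_map_monomial (s : seq L) :
  face_map (0%N, 0%N) (\prod_(v <- s) xvar K v) = 'X_[toric_weight s].
Proof.
rewrite rmorph_prod /=; under eq_bigr do rewrite face_map_xvar /=.
by rewrite -(big_map (fun u : L => toric_exponent (fsval u)) predT (fun m => 'X_[m]))
   mpolyX_prod big_map.
Qed.

Lemma toric_weight_cols (s : seq L) (i : 'I_B.+1) :
  toric_weight s (lshift _ i) = count_mem (i : nat) (map (fun u : L => (fsval u).1) s).
Proof.
rewrite /toric_weight mnm_sumE -sum1_count big_map [RHS]big_mkcond /=.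
apply: eq_bigr => u _; rewrite mnmDE !mnm1E eq_lshift eq_rlshift addn0.
rewrite -val_eqE /= inordK; last by case: (vertex_bounds u).
by case: eqP.
Qed.

Lemma toric_weight_rows (s : seq L) (i : 'I_B.+1) :
  toric_weight s (rshift _ i) = count_mem (i : nat) (map (fun u : L => (fsval u).2) s).
Proof.
rewrite /toric_weight mnm_sumE -sum1_count big_map [RHS]big_mkcond /=.
apply: eq_bigr => u _; rewrite mnmDE !mnm1E eq_rshift eq_lrshift add0n.
rewrite -val_eqE /= inordK; last by case: (vertex_bounds u).
by case: eqP.
Qed.

(** The exponents give the multisets of columns and of rows; in a multichain both
    are sorted in the order of the chain. *)
Lemma toric_weight_inj k (s t : k.-tuple L) :
  s \in vertex_chains k -> t \in vertex_chains k ->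
  toric_weight s = toric_weight t -> s = t.
Proof.
rewrite !mem_vertex_chains => ss st est.
have srt (h : point -> nat) (r : k.-tuple L) :
    (forall u v, geq2 u v -> h v <= h u)%N -> sorted geq2 (map (@fsval _ L) r) ->
    sorted geq (map h (map (@fsval _ L) r)).
  by move=> hh; rewrite sorted_map; apply: sub_sorted => u v; apply: hh.
have cnt (h : L -> nat) (i : nat) (r : seq L) : (forall u, h u < B.+1)%N ->
    ~~ (i < B.+1)%N -> count_mem i (map h r) = 0%N.
  move=> hB iB; apply/count_memPn; apply: contra iB => /mapP[u _ ->]; exact: hB.
have pc : perm_eq (map (fun u : L => (fsval u).1) s) (map (fun u : L => (fsval u).1) t).
  apply/allP => i _ /=; have [iB|iB] := boolP (i < B.+1)%N.
    by rewrite -(toric_weight_cols s (Ordinal iB)) est toric_weight_cols.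
  by rewrite !cnt // => u; case: (vertex_bounds u).
have pr : perm_eq (map (fun u : L => (fsval u).2) s) (map (fun u : L => (fsval u).2) t).
  apply/allP => i _ /=; have [iB|iB] := boolP (i < B.+1)%N.
    by rewrite -(toric_weight_rows s (Ordinal iB)) est toric_weight_rows.
  by rewrite !cnt // => u; case: (vertex_bounds u).
have geq_trans : transitive geq by move=> b a c /= h1 h2; apply: leq_trans h2 h1.
have geq_anti : antisymmetric geq by move=> a b /=; rewrite andbC => /anti_leq.
apply/val_inj/(inj_map val_inj)/eq_map_fst_snd.
  apply: (sorted_eq geq_trans geq_anti); [| |by rewrite -!map_comp].
    by apply: srt ss => u v /andP[].
  by apply: srt st => u v /andP[].
apply: (sorted_eq geq_trans geq_anti); [| |by rewrite -!map_comp].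
  by apply: srt ss => u v /andP[].
by apply: srt st => u v /andP[].
Qed.

(** The toric images are pairwise distinct monomials. *)
Lemma chain_monomials_free k (c : 'I_#|vertex_chains k| -> K) :
  \sum_i c i *: vertex_monomial (enum_val i) = 0 -> forall i, c i = 0.
Proof.
pose f := \sum_i c i *: \prod_(v <- (enum_val i : k.-tuple L)) xvar K v.
rewrite (_ : \sum_i _ = pi f); last first.
  by rewrite raddf_sum; apply: eq_bigr => i _; rewrite -to_coord_ringZ.
rewrite -(rmorph0 pi) => /to_coord_ring_eq; rewrite subr0 => /(face_map_ideal (0%N, 0%N)).
have fZ i : face_map (0%N, 0%N) (c i *: \prod_(v <- (enum_val i : k.-tuple L)) xvar K v) =
    c i *: 'X_[toric_weight (enum_val i)].
  by rewrite /face_map mmapZ mul_mpolyC -/(face_map _) face_map_monomial.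
rewrite rmorph_sum /=; under eq_bigr do rewrite fZ.
move=> f0 j; have := congr1 (mcoeff (toric_weight (enum_val j))) f0.
rewrite mcoeff0 raddf_sum (bigD1 j) //= mcoeffZ mcoeffX eqxx mulr1.
rewrite big1 ?addr0 // => i ij; rewrite mcoeffZ mcoeffX.
case: eqP => [ew|]; rewrite ?mulr0 //.
by case/eqP: ij; apply/enum_val_inj/(toric_weight_inj _ _ ew); apply: enum_valP.
Qed.

Theorem graded_piece_dim k : has_dim (@graded_piece K P k) (multichains P k e).
Proof.
rewrite -card_vertex_chains.
exists (fun i : 'I_#|vertex_chains k| => vertex_monomial (enum_val i)); split.
- move=> i; exists (\prod_(v <- (enum_val i : k.-tuple L)) xvar K v) => //.
  by have := vertex_monomial_homog (enum_val i); rewrite size_tuple.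
- exact: chain_monomials_free.
exact: graded_piece_span.
Qed.

(** * The Krull dimension of the coordinate ring *)

Definition degree_le (d : nat) (x : A) : Prop :=
  exists2 l : seq (K * seq L), all (fun p => size p.2 <= d)%N l &
    x = \sum_(p <- l) p.1 *: vertex_monomial p.2.

Lemma degree_le_ex (x : A) : exists d, degree_le d x.
Proof.
have [f ->] := to_coord_ring_surj x; have /choice[s hs] := mpolyX_vertices.
exists (\max_(m <- msupp f) mdeg m), [seq (f@_m, s m) | m <- msupp f].
  apply/allP => _ /mapP[m mf ->] /=; rewrite (hs m).1.
  exact: (leq_bigmax_seq _ mf isT).
rewrite to_coord_ringE [RHS]big_map; apply: eq_bigr => m _ /=.
by rewrite (hs m).2.
Qed.

Lemma degree_leW d d' x : (d <= d')%N -> degree_le d x -> degree_le d' x.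
Proof.
move=> dd [l ld ->]; exists l => //; apply: sub_all ld => p h.
exact: leq_trans dd.
Qed.

Lemma degree_le1 : degree_le 0 1.
Proof.
exists [:: (1, [::])] => //.
by rewrite big_seq1 scale1r /vertex_monomial big_nil rmorph1.
Qed.

Lemma degree_leM d d' x y : degree_le d x -> degree_le d' y ->
  degree_le (d + d') (x * y).
Proof.
move=> [l ld ->] [l' ld' ->].
exists [seq (p.1 * q.1, p.2 ++ q.2) | p <- l, q <- l'].
  apply/allP => _ /allpairsP[[p q] /= [pl ql ->]] /=; rewrite size_cat.
  by apply: leq_add; [apply: (allP ld)|apply: (allP ld')].
rewrite big_allpairs_dep mulr_suml; apply: eq_bigr => p _.
rewrite mulr_sumr; apply: eq_bigr => q _ /=.
rewrite vertex_monomial_cat !coord_scaleE mpolyCM rmorphM.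
by rewrite mulrACA.
Qed.

Lemma degree_le_exp d x n : degree_le d x -> degree_le (n * d) (x ^+ n).
Proof.
move=> xd; elim: n => [|n IH]; first by rewrite expr0 mul0n; apply: degree_le1.
by rewrite exprS mulSn; apply: degree_leM.
Qed.

(** The generators are indexed by a box whose size does not depend on the number of
    multichains, padding with zeros, so that its cardinality is immediate. *)
Lemma degree_le_span E x : degree_le E x ->
  in_span (fun ki : 'I_E.+1 * 'I_((2 * E.+1) ^ rank o e) =>
    nth 0 [seq vertex_monomial (t : ki.1.-tuple L) | t <- enum (vertex_chains ki.1)]
      ki.2) x.
Proof.
case=> l /allP lE ->; apply: (in_span_sum fst) => p pl.
have [t tC ->] := straighten_chain p.2.
have kE : (size p.2 < E.+1)%N by rewrite ltnS; apply: lE.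
have ti : (index t (enum (vertex_chains (size p.2))) < #|vertex_chains (size p.2)|)%N.
  by rewrite cardE index_mem mem_enum.
have iE : (index t (enum (vertex_chains (size p.2))) < (2 * E.+1) ^ rank o e)%N.
  apply: leq_trans ti _; rewrite card_vertex_chains.
  apply: leq_trans (multichains_bound PL (pl_top PL) _) _.
  by apply: leq_expl; rewrite leq_mul2l.
have := in_span_gen (fun ki : 'I_E.+1 * 'I_((2 * E.+1) ^ rank o e) =>
    nth 0 [seq vertex_monomial (t : ki.1.-tuple L) | t <- enum (vertex_chains ki.1)]
      ki.2) (Ordinal kE, Ordinal iE).
by rewrite /= (nth_map t) ?nth_index ?mem_enum // -cardE.
Qed.

Lemma ideal_mull (R : comNzRingType) (I : {pred R}) a u :
  prime_ideal I -> u \in I -> a * u \in I.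
Proof. by case=> -[I0 _ lin] _ uI; rewrite -[a * u]addr0; apply: lin. Qed.

Lemma ideal_subr (R : comNzRingType) (I : {pred R}) u v :
  prime_ideal I -> u \in I -> v + u \in I -> v \in I.
Proof.
case=> -[I0 _ lin] _ uI vuI.
by rewrite (_ : v = -1 * u + (v + u)); [apply: lin|ring].
Qed.

(** Modulo q only the lowest coefficient of the sum survives, so it vanishes; then
    x can be cancelled modulo p and the remaining coefficients are treated in the
    same way. *)
Lemma prime_step_free (R : comNzRingType) (p q : {pred R}) (x : R) m (Y : 'I_m -> R) :
  prime_ideal p -> prime_ideal q -> {subset p <= q} -> x \in q -> x \notin p ->
  (forall a, Y a \in q -> Y a = 0) ->
  \sum_(a < m) x ^+ a * Y a \in p -> forall a, Y a = 0.
Proof.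
move=> pp pq pq_sub xq xp; elim: m Y => [|m IH] Y hY; first by move=> _ [].
rewrite big_ord_recl expr0 mul1r.
rewrite (eq_bigr (fun a : 'I_m => x * (x ^+ a * Y (lift ord0 a)))); last first.
  by move=> a _; rewrite /= /bump /= add1n exprS mulrA.
rewrite -mulr_sumr => h.
have Y0 : Y ord0 = 0.
  apply/hY/(ideal_subr pq _ (pq_sub _ h)).
  by rewrite mulrC; apply: ideal_mull.
move: h; rewrite Y0 add0r => /pp.2; rewrite (negPf xp) /= => h a.
have [b ->|->] := unliftP ord0 a => //.
by apply: (IH (fun b => Y (lift ord0 b))) => // b'; apply: hY.
Qed.

Fixpoint power_product (x : nat -> A) (j : nat) (a : seq nat) : A :=
  if a is b :: a' then x j ^+ b * power_product x j.+1 a' else 1.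

(** Elements chosen in the successive differences of a chain of primes are
    algebraically independent over K: [prime_step_free] eliminates them one by one,
    until a nonzero constant would lie in the last prime. *)
Lemma prime_chain_free n (p : nat -> {pred A}) (x : nat -> A) m :
  prime_chain n p -> (forall i, (i < n)%N -> x i \in p i.+1 /\ x i \notin p i) ->
  forall r j (c : r.-tuple 'I_m -> K), (j + r = n)%N ->
  \sum_t c t *: power_product x j (map val t) \in p j -> forall t, c t = 0.
Proof.
move=> [pprime psub] hx; elim=> [|r IH] j c jn.
  rewrite (big_pred1 [tuple]) => [h t|t]; last by apply/esym/eqP; exact: tuple0.
  rewrite tuple0; apply/eqP; apply: contraTT h => c0.
  have pj : prime_ideal (p j) by apply: pprime; rewrite -jn addn0.
  have [[_ one_p _] _] := pj; apply: contra one_p => h.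
  have -> : (1 : A) = pi (c [tuple])^-1%:MP * (c [tuple] *: (1 : A)).
    by rewrite -coord_scaleE scalerA mulVf // scale1r.
  exact: ideal_mull.
rewrite big_cons_tuple => h.
pose Y a := \sum_(t : r.-tuple 'I_m) c [tuple of a :: t] *: power_product x j.+1 (map val t).
have jn' : (j.+1 + r = n)%N by rewrite addSnnS.
have ltj : (j < n)%N by rewrite -jn' leq_addr.
have Yc a : Y a \in p j.+1 -> forall t : r.-tuple 'I_m, c [tuple of a :: t] = 0.
  exact: (IH j.+1 (fun t => c [tuple of a :: t]) jn').
have Y0 : forall a, Y a \in p j.+1 -> Y a = 0.
  by move=> a /Yc ca; rewrite /Y big1 // => t _; rewrite ca scale0r.
have YY : forall a, Y a = 0.
  apply: (@prime_step_free _ (p j) (p j.+1) (x j)) => //.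
  - exact/pprime/ltnW.
  - exact/pprime.
  - exact: (psub j ltj).1.
  - exact: (hx j ltj).1.
  - exact: (hx j ltj).2.
  move: h; congr (_ \in p j); apply: eq_bigr => a _; rewrite mulr_sumr; apply: eq_bigr => t _ /=.
  by rewrite !coord_scaleE mulrCA.
move=> t; case: (tupleP t) => a u; apply: Yc.
by rewrite YY; have [[]] := pprime _ ltj.
Qed.

(** The m^n power products with exponents below m are independent and lie in degree
    O(m), a space of dimension O(m^(r + 1)) where r is the rank of the lattice. *)
Lemma prime_chain_le n (p : nat -> {pred A}) :
  prime_chain n p -> (n <= (rank o e).+1)%N.
Proof.
move=> pc; have [pprime psub] := pc.
have /choice[x hx] : forall i, exists y, (i < n)%N -> y \in p i.+1 /\ y \notin p i.
  move=> i; have [lt|_] := ltnP i n; last by exists 0.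
  by have [_ [y y1 y2]] := psub i lt; exists y.
have [d hd] : exists d, forall i, (i < n)%N -> degree_le d (x i).
  elim: (n) => [|k [d hd]]; first by exists 0%N.
  have [d' hd'] := degree_le_ex (x k); exists (maxn d d') => i.
  rewrite ltnS leq_eqVlt => /orP[/eqP->|/hd hi].
    exact: degree_leW (leq_maxr _ _) hd'.
  exact: degree_leW (leq_maxl _ _) hi.
have deg m j (a : seq nat) : (j + size a <= n)%N -> all (fun b => b < m)%N a ->
    degree_le (size a * (m * d)) (power_product x j a).
  elim: a j => [|b a IH] j /=; first by move=> _ _; apply: degree_le1.
  rewrite addnS -addSn => jn /andP[bm am]; rewrite mulSn; apply: degree_leM.
    apply: (@degree_leW (b * d)); first by rewrite leq_mul2r ltnW ?orbT.
    by apply/degree_le_exp/hd; apply: leq_trans jn; rewrite ltnS leq_addr.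
  exact: IH.
have count m : (m ^ n <= (2 * (n * (m * d)).+1) ^ (rank o e).+1)%N.
  rewrite -[X in (X ^ n)%N]card_ord -card_tuple expnS -mulnA.
  apply: leq_trans (leq_pmull _ (isT : 0 < 2)%N).
  rewrite -[X in (X * _)%N]card_ord -[X in (_ * X)%N]card_ord -card_prod.
  apply: (@free_card_le K _ _ _ (fun t : n.-tuple 'I_m => power_product x 0 (map val t))).
    move=> c c0; apply: (prime_chain_free pc hx (j := 0) (c := c)) => //.
    by rewrite c0; have [[]] := pprime 0 (leq0n _).
  move=> t; apply: degree_le_span.
  have := deg m 0 (map val t); rewrite size_map size_tuple; apply=> //.
  by apply/allP => _ /mapP[a _ ->] /=.
rewrite leqNgt; apply/negP => lt.
(* With m = C + 1 the count reads (C + 1)^n <= C (C + 1)^(r + 1). *)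
pose C := ((2 * (n * d).+1) ^ (rank o e).+1)%N.
have := count C.+1.
have le1 : (C.+1 ^ (rank o e).+2 <= C.+1 ^ n)%N by rewrite leq_pexp2l.
have le2 : ((2 * (n * (C.+1 * d)).+1) ^ (rank o e).+1 <= C * C.+1 ^ (rank o e).+1)%N.
  rewrite /C -expnMn; apply: leq_expl.
  by rewrite -/C; nia.
move=> le3; have := leq_trans (leq_trans le1 le3) le2.
by rewrite expnS leq_pmul2r ?expn_gt0 // ltnn.
Qed.

Lemma saturated_chain (v : point) : v \in L -> exists f : nat -> point,
  [/\ f (rank o v) = v, forall i, (i <= rank o v)%N -> f i \in L &
      forall i, (i < rank o v)%N -> ne_step (f i) (f i.+1)].
Proof.
have extend (u w : point) : w \in L -> u \in L -> ne_step u w ->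
    (exists f : nat -> point, [/\ f (rank o u) = u,
       forall i, (i <= rank o u)%N -> f i \in L &
       forall i, (i < rank o u)%N -> ne_step (f i) (f i.+1)]) ->
    exists f : nat -> point, [/\ f (rank o w) = w,
       forall i, (i <= rank o w)%N -> f i \in L &
       forall i, (i < rank o w)%N -> ne_step (f i) (f i.+1)].
  move=> wL uL uw [f [fu fL fs]]; have rw := rank_step PL uL uw.
  exists (fun i => if (i <= rank o u)%N then f i else w); rewrite rw; split.
  - by rewrite ltnn.
  - by move=> i _; case: ifP => // /fL.
  move=> i; rewrite ltnS => iu; rewrite iu; case: ifP => [/fs //|/negbT].
  by rewrite -leqNgt => ui; rewrite (_ : i = rank o u) ?fu //; lia.
move: v; apply: (planar_ind PL) => [|v w vL wL wv _|x y vL cP l0 l1 l2 _ IH _].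
- exists (fun=> o); split=> //; first by move=> i _; exact: pl_bot PL.
  by rewrite /rank subnn.
- exact: extend.
exact: extend vL l1 (ne_step_east _ _) IH.
Qed.

Lemma mpolyX_neq0 n (m : 'X_{1..n}) : 'X_[m] != 0 :> {mpoly K[n]}.
Proof.
by apply/eqP => /(congr1 (mcoeff m)); rewrite mcoeffX eqxx mcoeff0 => /eqP; rewrite oner_eq0.
Qed.

(** Along a saturated chain of vertices the face ideals increase strictly, since
    the i-th vertex is killed exactly from step i + 1 on; a last step beyond the
    top kills every vertex. *)
Theorem coord_ring_krull_dim : has_krull_dim A (rank o e).+1.
Proof.
split; last by move=> n p; apply: prime_chain_le.
have [f [fe fL fs]] := saturated_chain (pl_top PL).
(* The extra point is above no vertex. *)
pose F i := if (i <= rank o e)%N then f i else (e.1.+1, e.2).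
have Fs i : (i < (rank o e).+1)%N -> ne_step (F i) (F i.+1).
  rewrite ltnS /F => ie; rewrite ie; case: ifP => [/fs //|/negbT].
  by rewrite -leqNgt => ei; rewrite (_ : i = rank o e) ?fe ?/ne_step ?eqxx //; lia.
exists (fun i => face_ideal (F i)); split=> [i _|i ilt]; first exact: face_ideal_prime.
have sF := Fs i ilt.
have [le nle] : leq2 (F i) (F i.+1) /\ leq2 (F i.+1) (F i) = false.
  by move: sF; rewrite /leq2 => /orP[]/eqP-> /=; split; lia.
split; first exact: face_ideal_sub.
have FL : F i \in L by rewrite /F -ltnS ilt; apply: fL.
exists (pi (xvar K [` FL]%fset)); rewrite mem_face_ideal face_map_xvar /=.
  by rewrite nle.
by rewrite /leq2 !leqnn /= mpolyX_neq0.
Qed.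

End CoordinateRing.

(** * The numerator of the Hilbert series *)

Lemma has_krull_dim_uniq (R : comNzRingType) m n :
  has_krull_dim R m -> has_krull_dim R n -> m = n.
Proof.
move=> [[p pc] le_m] [[q qc] le_n]; apply/eqP; rewrite eqn_leq.
by rewrite (le_n _ _ pc) (le_m _ _ qc).
Qed.

Theorem h_polynomial_planar (K : fieldType) (P : {fset (nat * nat)%type})
    (o e : point) (h : {poly int}) : planar_lattice P o e ->
  is_h_polynomial K P h <-> h = switching_rook_poly P.
Proof.
move=> PL; have numerator : series_numerator (rank o e).+1
    (fun k => multichains P k e) (switching_rook_poly P).
  move=> n; rewrite (coef_switching_rook_poly PL).
  rewrite -(multichains_numerator PL (pl_top PL)).
  exact: iter_backward_difference.
split=> [[d [H [dimA HA num]]]|->].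
  have ed := has_krull_dim_uniq dimA (coord_ring_krull_dim K PL).
  apply/polyP => n; rewrite -num -numerator ed; apply: eq_bigr => i _.
  by rewrite (has_dim_uniq (HA _) (graded_piece_dim K PL _)).
exists (rank o e).+1, (fun k => multichains P k e); split=> //.
  exact: coord_ring_krull_dim PL.
by move=> k; exact: graded_piece_dim PL k.
Qed.

Theorem theorem3p5 (K : fieldType) (P : {fset (nat * nat)%type})
    (hP : parallelogram_polyomino P) (h : {poly int}) :
  is_h_polynomial K P h <-> h = switching_rook_poly P.
Proof.
case: hP => k [s1 [s2 [[path1 path2] first_eq last_eq above cellsP]]].
exact: h_polynomial_planar (region_planar_lattice path1 path2 first_eq last_eq above cellsP).
Qed.
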